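(* Let $\Bbbk$ be an algebraically closed field, let $\Lambda$ be a finite dimensional basic $\Bbbk$-algebra, and let $\widehat{\Lambda}$ be the repetitive algebra of $\Lambda$. Let $$\widehat{M}\xrightarrow{\underline{\widehat{h}}}\widehat{M}'\xrightarrow{\underline{\widehat{h}}'}\widehat{M}''\xrightarrow{\underline{\widehat{h}}''}\Omega^{-1}\widehat{M}\qquad(\ast)$$ be an Auslander-Reiten triangle in $\widehat{\Lambda}\text{-}\underline{\mathrm{mod}}$ such that neither $\widehat{M}$ nor $\widehat{M}'$ nor $\widehat{M}''$ has projective direct summands in $\widehat{\Lambda}\text{-mod}$. Then there exists an Auslander-Reiten sequence in $\widehat{\Lambda}\text{-mod}$ $$0\to\widehat{M}\xrightarrow{(\widehat{h},\widehat{\alpha})^t}\widehat{M}'\oplus\widehat{P}\xrightarrow{(\widehat{g},\widehat{\beta})}\widehat{M}''\to 0$$ such that $\widehat{P}$ is a projective $\widehat{\Lambda}$-module and this sequence induces the Auslander-Reiten triangle $(\ast)$. Moreover, if $\widehat{P}\neq 0$, then $\widehat{P}$ is indecomposable, $\widehat{M}\cong\mathrm{rad}\,\widehat{P}$ and $\widehat{M}''\cong\widehat{P}/\mathrm{soc}\,\widehat{P}$ as $\widehat{\Lambda}$-modules.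
   Context: All modules are finitely generated left modules. Let $Q=D\Lambda=\mathrm{Hom}_\Bbbk(\Lambda,\Bbbk)$ with its canonical $\Lambda$-$\Lambda$-bimodule structure. The repetitive algebra $\widehat{\Lambda}$ has underlying space $\left(\bigoplus_{i\in\mathbb{Z}}\Lambda\right)\oplus\left(\bigoplus_{i\in\mathbb{Z}}Q\right)$, with elements $(a_i,\varphi_i)_i$ (almost all $a_i\in\Lambda$, $\varphi_i\in Q$ zero) and product $(a_i,\varphi_i)_i\cdot(b_i,\psi_i)_i=(a_ib_i,a_{i+1}\psi_i+\varphi_ib_i)_i$. The category $\widehat{\Lambda}\text{-mod}$ is described as follows: objects are $\widehat{M}=(M_i,f_i)_{i\in\mathbb{Z}}$ with $M_i$ finitely generated $\Lambda$-modules, almost all zero, and $\Lambda$-morphisms $f_i:Q\otimes_\Lambda M_i\to M_{i+1}$ with $f_{i+1}\circ(\mathrm{id}_Q\otimes f_i)=0$; a morphism $\widehat{h}:\widehat{M}\to\widehat{M}'$ is a sequence $\widehat{h}=(h_i)_{i\in\mathbb{Z}}$ of $\Lambda$-morphisms $h_i:M_i\to M_i'$ with $h_{i+1}\circ f_i=f_i'\circ(\mathrm{id}_Q\otimes h_i)$ for all $i$. $\widehat{\Lambda}\text{-mod}$ is a Frobenius category (projectives and injectives coincide). Its stable category $\widehat{\Lambda}\text{-}\underline{\mathrm{mod}}$ has the same objects, and morphisms are morphisms of $\widehat{\Lambda}\text{-mod}$ modulo those factoring through a finitely generated projective-injective $\widehat{\Lambda}$-module; $\underline{\widehat{h}}$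 denotes the class of $\widehat{h}$. It is triangulated with translation functor $\Omega^{-1}$, where $\Omega^{-1}\widehat{M}$ is the cokernel of an injective hull $\widehat{M}\to I(\widehat{M})$; distinguished triangles come from pushouts of $0\to\widehat{M}\to I(\widehat{M})\to\Omega^{-1}\widehat{M}\to 0$ along morphisms $\widehat{h}:\widehat{M}\to\widehat{M}'$ (the standard triangulated structure on the stable category of a Frobenius category). Every short exact sequence $0\to\widehat{X}\to\widehat{Y}\to\widehat{Z}\to0$ in $\widehat{\Lambda}\text{-mod}$ yields a distinguished triangle $\widehat{X}\to\widehat{Y}\to\widehat{Z}\to\Omega^{-1}\widehat{X}$ whose first two maps are the stable classes of the given maps; the sequence is said to induce a given triangle if this distinguished triangle is isomorphic to it (projective summands being zero objects in the stable category). A split mono (resp. split epi) is a morphism with a left (resp. right) inverse. A short exact sequence $0\to\widehat{X}\xrightarrow{\widehat{a}}\widehat{Y}\xrightarrow{\widehat{b}}\widehat{Z}\to0$ in $\widehat{\Lambda}\text{-mod}$ is an Auslander-Reiten sequence if: $\widehat{a}$ is not a split mono and every morphism $\widehat{v}:\widehat{X}\to\widehat{N}$ that is not a split mono factors as $\widehat{v}=\widehat{u}\circ\widehat{a}$; and $\widehat{b}$ is not a split epi and every morphism $\widehat{u}':\widehat{N}'\to\widehat{Z}$ that is not a split epi factors as $\widehat{u}'=\widehat{b}\circ\widehat{v}'$. A distinguished triangle $\widehat{M}\xrightarrow{\underline{\widehat{h}}}\widehat{M}'\xrightarrow{\underline{\widehat{h}}'}\widehat{M}''\xrightarrow{\underline{\widehat{h}}''}\Omega^{-1}\widehat{M}$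 is an Auslander-Reiten triangle if: $\widehat{M}$ and $\widehat{M}''$ are indecomposable; $\underline{\widehat{h}}''\neq 0$; and every morphism $\underline{\widehat{u}}':\widehat{N}'\to\widehat{M}''$ in $\widehat{\Lambda}\text{-}\underline{\mathrm{mod}}$ that is not a split epi factors as $\underline{\widehat{u}}'=\underline{\widehat{h}}'\circ\underline{\widehat{v}}'$ for some $\underline{\widehat{v}}':\widehat{N}'\to\widehat{M}'$. *)

(* Defs.v *)
From HB Require Import structures.
From mathcomp Require Import all_boot all_order all_algebra all_field.
From mathcomp Require Import ring_quotient generic_quotient.
From mathcomp Require Import boolp.
From mathcomp Require Import freeg.

Set Implicit Arguments.
Unset Strict Implicit.
Unset Printing Implicit Defensive.

Import GRing.Theory.
Local Open Scope ring_scope.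
Local Open Scope quotient_scope.

Section Modules.
Variable R : nzRingType.

Record submodule (V : lmodType R) := Submodule {
  sm_mem :> V -> Prop;
  sm_mem0 : sm_mem 0;
  sm_memP : forall (a : R) x y, sm_mem x -> sm_mem y -> sm_mem (a *: x + y) }.

Section Sub.
Variables (V : lmodType R) (S : submodule V).

Definition sm_pred : V -> bool := fun x => `[< S x >].

Lemma sm_pred_closed : submod_closed sm_pred.
Proof.
split; first by apply/asboolP; exact: sm_mem0.
by move=> a x y /asboolP Sx /asboolP Sy; apply/asboolP; exact: sm_memP.
Qed.

HB.instance Definition _ :=
  GRing.isSubmodClosed.Build R V sm_pred sm_pred_closed.

Record sm_type := SmType { sm_val : V; sm_valP : sm_val \in sm_pred }.
HB.instance Definition _ := [isSub for sm_val].
HB.instance Definition _ := [Choice of sm_type by <:].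
HB.instance Definition _ := [SubChoice_isSubLmodule of sm_type by <:].

Definition sm_quot := Quotient.quot (GRing.ZmodClosed.clone V sm_pred _).
HB.instance Definition _ := GRing.Zmodule.on sm_quot.
HB.instance Definition _ := Quotient.on sm_quot.

Definition sm_proj (x : V) : sm_quot := \pi_sm_quot x.

Lemma sm_projE x y : sm_proj x = sm_proj y <-> S (x - y).
Proof.
split; first by move=> /eqP; rewrite -Quotient.idealrBE => /asboolP.
by move=> Sxy; apply/eqP; rewrite -Quotient.idealrBE; apply/asboolP.
Qed.

Lemma sm_projK (x : sm_quot) : sm_proj (repr x) = x.
Proof. exact: reprK. Qed.

Lemma sm_projD x y : sm_proj (x + y) = sm_proj x + sm_proj y.
Proof. exact: raddfD. Qed.

Definition sm_scale (a : R) (x : sm_quot) : sm_quot := sm_proj (a *: repr x).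

Lemma sm_scaleE a x : sm_scale a (sm_proj x) = sm_proj (a *: x).
Proof.
apply/sm_projE; rewrite -scalerBr -[_ *: _]addr0; apply: sm_memP.
  by apply/sm_projE; rewrite sm_projK.
exact: sm_mem0.
Qed.

Fact sm_scaleA a b x : sm_scale a (sm_scale b x) = sm_scale (a * b) x.
Proof. by rewrite -[x]sm_projK !sm_scaleE scalerA. Qed.
Fact sm_scale1 : left_id 1 sm_scale.
Proof. by move=> x; rewrite -[x]sm_projK !sm_scaleE scale1r. Qed.
Fact sm_scaleDr : right_distributive sm_scale +%R.
Proof.
move=> a x y; rewrite -[x]sm_projK -[y]sm_projK -sm_projD !sm_scaleE.
by rewrite scalerDr sm_projD.
Qed.
Fact sm_scaleDl x : {morph sm_scale^~ x : a b / a + b}.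
Proof. by move=> a b; rewrite -[x]sm_projK !sm_scaleE scalerDl sm_projD. Qed.

HB.instance Definition _ := GRing.Zmodule_isLmodule.Build R sm_quot
  sm_scaleA sm_scale1 sm_scaleDr sm_scaleDl.

Fact sm_proj_linear : linear sm_proj.
Proof. by move=> a x y; rewrite sm_projD -sm_scaleE. Qed.
HB.instance Definition _ :=
  GRing.isLinear.Build R V sm_quot *:%R sm_proj sm_proj_linear.

Lemma sm_projZ a x : sm_proj (a *: x) = a *: sm_proj x.
Proof. exact: linearZ. Qed.

Variables (W : lmodType R) (g : {linear V -> W}).
Variable gS : forall x, S x -> g x = 0.

Definition sm_lift (_ : forall x, S x -> g x = 0) (x : sm_quot) : W :=
  g (repr x).

Lemma sm_liftE x : sm_lift gS (sm_proj x) = g x.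
Proof.
apply/eqP; rewrite -subr_eq0 -linearB; apply/eqP/gS/sm_projE.
by rewrite sm_projK.
Qed.

Fact sm_lift_linear : linear (sm_lift gS).
Proof.
move=> a x y; rewrite -[x]sm_projK -[y]sm_projK -linearP !sm_liftE.
exact: linearP.
Qed.
HB.instance Definition _ :=
  GRing.isLinear.Build R sm_quot W *:%R (sm_lift gS) sm_lift_linear.

End Sub.

(* The submodule generated by X, as the intersection of the submodules that
   contain X. *)
Section Span.
Variables (V : lmodType R) (X : V -> Prop).

Definition sm_span_mem (x : V) : Prop :=
  forall S : submodule V, (forall y, X y -> S y) -> S x.

Fact sm_span0 : sm_span_mem 0.
Proof. by move=> S _; exact: sm_mem0. Qed.
Fact sm_spanP a x y :
  sm_span_mem x -> sm_span_mem y -> sm_span_mem (a *: x + y).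
Proof. by move=> Sx Sy S XS; apply: sm_memP; [exact: Sx | exact: Sy]. Qed.

Definition sm_span := Submodule sm_span0 sm_spanP.
End Span.

Definition fin_gen (V : lmodType R) : Prop :=
  exists (n : nat) (g : 'I_n -> V),
    forall x, exists c : 'I_n -> R, x = \sum_i c i *: g i.

Lemma fin_gen_quot (V : lmodType R) (S : submodule V) :
  fin_gen V -> fin_gen (sm_quot S).
Proof.
move=> [n [g gP]]; exists n, (fun i => sm_proj S (g i)) => x.
have [c xE] := gP (repr x); exists c; rewrite -[x]sm_projK xE linear_sum /=.
by apply: eq_bigr => i _; rewrite linearZ.
Qed.

Lemma fin_gen_prod (V W : lmodType R) :
  fin_gen V -> fin_gen W -> fin_gen (V * W)%type.
Proof.
move=> [n [g gP]] [m [h hP]].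
exists (n + m)%N, (fun i => match split i with
  | inl j => (g j, 0) | inr j => (0, h j) end) => -[x y].
have [c xE] := gP x; have [d yE] := hP y.
exists (fun i => match split i with inl j => c j | inr j => d j end).
rewrite big_split_ord /=.
under eq_bigr => i _.
  have -> : split (lshift m i) = inl i by rewrite -/(unsplit (inl i)) unsplitK.
  over.
under [X in _ + X]eq_bigr => i _.
  have -> : split (rshift n i) = inr i by rewrite -/(unsplit (inr i)) unsplitK.
  over.
rewrite [RHS]surjective_pairing !raddfD /= !raddf_sum /=; congr (_, _).
  rewrite [X in _ + X]big1 ?addr0 => [|i _]; last by rewrite scaler0.
  by rewrite xE.
rewrite [X in X + _]big1 ?add0r => [|i _]; last by rewrite scaler0.
by rewrite yE.
Qed.

End Modules.

Section Dual.
Variables (K : fieldType) (L : falgType K).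

Definition dual_bimod := 'Hom(L, K^o).

(* (a phi)(x) = phi (x a) and (phi b)(x) = phi (b x). *)
Definition dual_lact (a : L) (phi : dual_bimod) : dual_bimod :=
  (phi \o amulr a)%VF.
Definition dual_ract (phi : dual_bimod) (b : L) : dual_bimod :=
  (phi \o amull b)%VF.

Lemma dual_lactE a phi x : dual_lact a phi x = phi (x * a).
Proof. by rewrite !lfunE /= lfunE. Qed.
Lemma dual_ractE phi b x : dual_ract phi b x = phi (b * x).
Proof. by rewrite !lfunE /= lfunE. Qed.

(* [Q ⊗_L V] is the left L-module generated by the symbols q ⊗ v subject to
   biadditivity, (q a) ⊗ v = q ⊗ (a v) and (a q) ⊗ v = a (q ⊗ v). *)
Section Tensor.
Variable V : lmodType L.

Local Notation symb q v :=
  (<< (q : dual_bimod, v : V) >> : {freeg (dual_bimod * V) / L}).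

Inductive tens_rel : {freeg (dual_bimod * V) / L} -> Prop :=
| TensAddl q q' v : tens_rel (symb (q + q') v - (symb q v + symb q' v))
| TensAddr q v v' : tens_rel (symb q (v + v') - (symb q v + symb q v'))
| TensMid q a v : tens_rel (symb (dual_ract q a) v - symb q (a *: v))
| TensLeft a q v : tens_rel (symb (dual_lact a q) v - a *: symb q v).

Definition tens := sm_quot (sm_span tens_rel).
HB.instance Definition _ := GRing.Lmodule.on tens.

Definition pure (q : dual_bimod) (v : V) : tens :=
  sm_proj (sm_span tens_rel) (symb q v).

Lemma tens_relE x y : tens_rel (x - y) ->
  sm_proj (sm_span tens_rel) x = sm_proj (sm_span tens_rel) y.
Proof. by move=> rxy; apply/sm_projE => S; apply. Qed.

Lemma pureDl q q' v : pure (q + q') v = pure q v + pure q' v.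
Proof. exact: etrans (tens_relE (TensAddl q q' v)) (sm_projD _ _ _). Qed.
Lemma pureDr q v v' : pure q (v + v') = pure q v + pure q v'.
Proof. exact: etrans (tens_relE (TensAddr q v v')) (sm_projD _ _ _). Qed.
Lemma pure0r q : pure q 0 = 0.
Proof. by apply: (addIr (pure q 0)); rewrite -pureDr !add0r. Qed.
Lemma pure_mid q a v : pure (dual_ract q a) v = pure q (a *: v).
Proof. exact: tens_relE (TensMid q a v). Qed.
Lemma pure_lact a q v : pure (dual_lact a q) v = a *: pure q v.
Proof. exact: etrans (tens_relE (TensLeft a q v)) (sm_projZ _ _ _). Qed.

Lemma freeg_mulU (c : L) (x : dual_bimod * V) :
  (<< c *g x >> : {freeg (dual_bimod * V) / L}) = c *: << x >>.
Proof. by apply/eqP/freeg_eqP => y; rewrite coeffZ !coeffU mul1r. Qed.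

Lemma tens_ind (P : tens -> Prop) :
    P 0 -> (forall a q v t, P t -> P (a *: pure q v + t)) -> forall t, P t.
Proof.
move=> P0 PD t; rewrite -[t]sm_projK -[repr t]freeg_sumE.
elim: (dom _) => [|x s IHs]; first by rewrite big_nil linear0.
by rewrite big_cons linearD freeg_mulU linearZ; case: x => q v; apply: PD.
Qed.

Record balanced (W : lmodType L) := Balanced {
  bal :> dual_bimod -> V -> W;
  balDl : forall q q' v, bal (q + q') v = bal q v + bal q' v;
  balDr : forall q v v', bal q (v + v') = bal q v + bal q v';
  bal_mid : forall q a v, bal (dual_ract q a) v = bal q (a *: v);
  bal_lact : forall a q v, bal (dual_lact a q) v = a *: bal q v }.

Section Lift.
Variables (W : lmodType L) (B : balanced W).

Definition free_lift : {freeg (dual_bimod * V) / L} -> W :=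
  fglift (fun x : dual_bimod * V => B x.1 x.2).

Fact free_liftU c x : free_lift << c *g x >> = c *: B x.1 x.2.
Proof. exact: liftU. Qed.

Fact free_lift_additive : zmod_morphism free_lift.
Proof. exact: lift_is_additive. Qed.
HB.instance Definition _ :=
  GRing.isZmodMorphism.Build _ _ free_lift free_lift_additive.

Fact free_lift_scalable : scalable free_lift.
Proof.
move=> a D; rewrite -(freeg_sumE D).
elim: (dom D) => [|x s IHs]; first by rewrite big_nil scaler0 raddf0 scaler0.
rewrite big_cons scalerDr !raddfD /= IHs; congr (_ + _).
by rewrite [in LHS]freeg_mulU scalerA -freeg_mulU !free_liftU scalerA.
Qed.
HB.instance Definition _ :=
  GRing.isScalable.Build L {freeg (dual_bimod * V) / L} W *:%R free_lift
    free_lift_scalable.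

Fact free_lift_ker x : sm_span tens_rel x -> free_lift x = 0.
Proof.
have ker0 : free_lift 0 = 0 by rewrite linear0.
have kerP a y z : free_lift y = 0 -> free_lift z = 0 -> free_lift (a *: y + z) = 0.
  by move=> y0 z0; rewrite linearP /= y0 z0 scaler0 addr0.
move/(_ (Submodule ker0 kerP)); apply => _ [] *;
  rewrite /= raddfB /= ?raddfD /= ?linearZ /= !free_liftU !scale1r /=.
- by rewrite balDl -opprD subrr.
- by rewrite balDr -opprD subrr.
- by rewrite bal_mid subrr.
- by rewrite bal_lact scalerN subrr.
Qed.

Definition tens_lift : tens -> W := sm_lift free_lift_ker.
HB.instance Definition _ := GRing.Linear.on tens_lift.

Lemma tens_liftE q v : tens_lift (pure q v) = B q v.
Proof. by rewrite /tens_lift sm_liftE /= free_liftU scale1r. Qed.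
End Lift.

Lemma tens_ext (W : lmodType L) (f g : {linear tens -> W}) :
  (forall q v, f (pure q v) = g (pure q v)) -> f =1 g.
Proof.
move=> fg; elim/tens_ind => [|a q v t IHt]; first by rewrite !linear0.
by rewrite !linearP IHt fg.
Qed.

End Tensor.

Section TensMap.
Variables (V W : lmodType L) (h : {linear V -> W}).

Definition tens_bal : balanced V (tens W).
Proof.
exists (fun q v => pure q (h v)).
- by move=> *; rewrite pureDl.
- by move=> *; rewrite linearD pureDr.
- by move=> *; rewrite linearZ pure_mid.
- by move=> *; rewrite pure_lact.
Defined.

(* The induced map id_Q ⊗ h. *)
Definition tens_map : tens V -> tens W := tens_lift tens_bal.
HB.instance Definition _ := GRing.Linear.on tens_map.

Lemma tens_mapE q v : tens_map (pure q v) = pure q (h v).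
Proof. exact: tens_liftE. Qed.
End TensMap.
End Dual.

Section Noetherian.
Variables (K : fieldType) (L : falgType K) (V : lmodType L) (S : submodule V).

Lemma fin_gen_sub : fin_gen V -> fin_gen (sm_type S).
Proof.
move=> [n [g gP]]; pose E := {ffun 'I_n -> L}.
pose phi (c : E) : V := \sum_i c i *: g i.
have phiD c d : phi (c + d) = phi c + phi d.
  by rewrite -big_split /=; apply: eq_bigr => i _; rewrite ffunE scalerDl.
have phiZ (k : K) c : phi (k *: c) = k%:A *: phi c.
  rewrite scaler_sumr; apply: eq_bigr => i _.
  by rewrite ffunE scalerA -scalerAl mul1r.
have phi0 : phi 0 = 0.
  by rewrite /phi big1 // => i _; rewrite ffunE scale0r.
have phi_sum (I : Type) (r : seq I) (F : I -> E) :
    phi (\sum_(i <- r) F i) = \sum_(i <- r) phi (F i).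
  by elim/big_rec2: _ => // i x y _ <-; rewrite phiD.
pose ok (d : nat) := `[< exists2 U : {vspace E}, \dim U = d &
  forall c, c \in U -> S (phi c) >].
have ok0 : exists d, ok d.
  exists 0%N; apply/asboolP; exists 0%VS; first exact: dimv0.
  by move=> c; rewrite memv0 => /eqP ->; rewrite phi0; exact: sm_mem0.
have ok_le d : ok d -> (d <= \dim {:E})%N.
  by move=> /asboolP[U <- _]; apply/dimvS/subvf.
case: (ex_maxnP ok0 ok_le) => _ /asboolP[U <- US] Umax.
have SU c : S (phi c) -> c \in U.
  move=> Sc; pose U' := (U + <[c]>)%VS.
  have /Umax : ok (\dim U').
    apply/asboolP; exists U' => // _ /memv_addP[u uU [v /vlineP[k ->] ->]].
    by rewrite phiD phiZ addrC; apply: sm_memP => //; exact: US.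
  move=> leU; have /eqP -> : U == U'.
    by rewrite eqEdim addvSl.
  by apply: (subvP (addvSr _ _)); exact: memv_line.
pose b := vbasis U.
have bS j : phi b`_(j : 'I_(\dim U)) \in sm_pred S.
  by apply/asboolP/US/vbasis_mem/mem_nth; rewrite size_tuple.
exists (\dim U), (fun j => SmType (bS j)) => -[x xS].
have [c xE] := gP x; pose cc : E := [ffun i => c i].
have xcc : x = phi cc by rewrite xE; apply: eq_bigr => i _; rewrite ffunE.
have ccU : cc \in U by apply: SU; rewrite -xcc; apply/asboolP.
exists (fun j => (coord b j cc)%:A); apply: val_inj.
rewrite raddf_sum /= xcc {1}(coord_vbasis ccU) phi_sum.
by apply: eq_bigr => j _; rewrite phiZ.
Qed.

End Noetherian.

(* Finitely generated modules over the repetitive algebra of L, as sequences of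
   L-modules with structure maps Q ⊗ M_i -> M_(i+1). *)

Section Repetitive.
Variables (K : fieldType) (L : falgType K).

Record rmod := Rmod {
  rmod_comp :> int -> lmodType L;
  rmod_str : forall i, {linear tens (rmod_comp i) -> rmod_comp (i + 1)};
  rmod_fg : forall i, fin_gen (rmod_comp i);
  rmod_bounded :
    exists s : seq int, forall i, i \notin s -> forall x : rmod_comp i, x = 0;
  rmod_str2 : forall i (x : tens (tens (rmod_comp i))),
    rmod_str (i + 1) (tens_map (rmod_str i) x) = 0 }.

Record rhom (M N : rmod) := Rhom {
  rhom_fun :> forall i, {linear M i -> N i};
  rhomP : forall i (x : tens (M i)),
    rhom_fun (i + 1) (rmod_str M i x) = rmod_str N i (tens_map (rhom_fun i) x) }.

(* Equality of morphisms; the proof component of [rhom] is ignored. *)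
Definition req (M N : rmod) (f g : rhom M N) : Prop :=
  forall i (x : M i), f i x = g i x.

Lemma rmod_str2_gen (M : int -> lmodType L)
    (s : forall i, {linear tens (M i) -> M (i + 1)}) :
    (forall i q q' (v : M i), s (i + 1) (pure q (s i (pure q' v))) = 0) ->
  forall i (x : tens (tens (M i))), s (i + 1) (tens_map (s i) x) = 0.
Proof.
move=> sP i; elim/tens_ind => [|a q t x IHx]; first by rewrite !linear0.
rewrite !linearP /= IHx addr0 tens_mapE.
suff -> : s (i + 1) (pure q (s i t)) = 0 by rewrite scaler0.
elim/tens_ind: t q => [|b q' v t IHt] q; first by rewrite linear0 pure0r linear0.
by rewrite linearP pureDr linearD -pure_mid sP IHt addr0.
Qed.

Lemma rmod_str2_pure (M : rmod) i q q' (v : M i) :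
  rmod_str M (i + 1) (pure q (rmod_str M i (pure q' v))) = 0.
Proof. by rewrite -(rmod_str2 (pure q (pure q' v))) tens_mapE. Qed.

Lemma rhom_gen (M N : rmod) (f : forall i, {linear M i -> N i}) :
    (forall i q (v : M i),
       f (i + 1) (rmod_str M i (pure q v)) = rmod_str N i (pure q (f i v))) ->
  forall i (x : tens (M i)),
    f (i + 1) (rmod_str M i x) = rmod_str N i (tens_map (f i) x).
Proof.
move=> fP i; elim/tens_ind => [|a q v x IHx]; first by rewrite !linear0.
by rewrite !linearP /= IHx fP tens_mapE.
Qed.

Lemma rhom_pure M N (f : rhom M N) i q (v : M i) :
  f (i + 1) (rmod_str M i (pure q v)) = rmod_str N i (pure q (f i v)).
Proof. by rewrite rhomP tens_mapE. Qed.

Fact rid_subproof (M : rmod) i q (v : M i) :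
  idfun (rmod_str M i (pure q v)) = rmod_str M i (pure q (idfun v)).
Proof. by []. Qed.
Definition rid (M : rmod) : rhom M M :=
  @Rhom M M (fun i => (idfun : {linear M i -> M i}))
    (rhom_gen (@rid_subproof M)).

Section Comp.
Variables (M N P : rmod) (g : rhom N P) (f : rhom M N).
Fact rcomp_subproof i q (v : M i) :
  (g (i + 1) \o f (i + 1)) (rmod_str M i (pure q v))
    = rmod_str P i (pure q ((g i \o f i) v)).
Proof. by rewrite /= !rhom_pure. Qed.
Definition rcomp : rhom M P :=
  @Rhom M P (fun i => (g i \o f i : {linear M i -> P i}))
    (rhom_gen rcomp_subproof).
End Comp.

Section Sub.
Variables (M N : rmod) (f g : rhom M N).
Fact rsubh_subproof i q (v : M i) :
  (f (i + 1) \- g (i + 1)) (rmod_str M i (pure q v))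
    = rmod_str N i (pure q ((f i \- g i) v)).
Proof.
rewrite /= !rhom_pure -linearB /=; congr (rmod_str N i _).
by apply/eqP; rewrite subr_eq -pureDr subrK.
Qed.
Definition rsubh : rhom M N :=
  @Rhom M N (fun i => (f i \- g i : {linear M i -> N i}))
    (rhom_gen rsubh_subproof).
End Sub.

Section Opp.
Variables (M N : rmod) (f : rhom M N).
Fact ropph_subproof i q (v : M i) :
  (\- f (i + 1)) (rmod_str M i (pure q v))
    = rmod_str N i (pure q ((\- f i) v)).
Proof.
rewrite /= !rhom_pure -linearN /=; congr (rmod_str N i _).
by apply/eqP; rewrite eq_sym -addr_eq0 -pureDr addNr pure0r.
Qed.
Definition ropph : rhom M N :=
  @Rhom M N (fun i => (\- f i : {linear M i -> N i}))
    (rhom_gen ropph_subproof).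
End Opp.

Definition rzero (M N : rmod) : rhom M N.
Proof.
exists (fun i => (\0 : {linear M i -> N i})).
by apply: rhom_gen => i q v /=; rewrite pure0r linear0.
Defined.

Section DirectSum.
Variables M N : rmod.

Definition dsum_comp i : lmodType L := (M i * N i)%type.

Definition dsum_bal i : balanced (dsum_comp i) (dsum_comp (i + 1)).
Proof.
exists (fun q v => (rmod_str M i (pure q v.1), rmod_str N i (pure q v.2))).
- by move=> q q' v; rewrite !pureDl !linearD.
- by move=> q v v'; rewrite /= !pureDr !linearD.
- by move=> q a v; rewrite /= !pure_mid.
- by move=> a q v; rewrite !pure_lact !linearZ.
Defined.

Definition dsum_str i : {linear tens (dsum_comp i) -> dsum_comp (i + 1)} :=
  tens_lift (dsum_bal i).

Fact dsum_fg i : fin_gen (dsum_comp i).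
Proof. by apply: fin_gen_prod; exact: rmod_fg. Qed.

Fact dsum_bounded :
  exists s : seq int, forall i, i \notin s -> forall x : dsum_comp i, x = 0.
Proof.
have [s sP] := rmod_bounded M; have [t tP] := rmod_bounded N.
exists (s ++ t) => i; rewrite mem_cat negb_or => /andP[/sP M0 /tP N0] [x y].
by rewrite (M0 x) (N0 y).
Qed.

Fact dsum_str2 i q q' (v : dsum_comp i) :
  dsum_str (i + 1) (pure q (dsum_str i (pure q' v))) = 0.
Proof. by rewrite /dsum_str /= !tens_liftE /= !rmod_str2_pure. Qed.

Definition dsum : rmod :=
  @Rmod dsum_comp dsum_str dsum_fg dsum_bounded (rmod_str2_gen dsum_str2).

End DirectSum.

Section Pairing.
Variables X M N : rmod.

(* (f, g)^t : X -> M ⊕ N *)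
Section Pair.
Variables (f : rhom X M) (g : rhom X N).
Definition rpair_fun i (x : X i) : dsum M N i := (f i x, g i x).
Fact rpair_linear i : linear (@rpair_fun i).
Proof. by move=> a x y; rewrite /rpair_fun !linearP. Qed.
HB.instance Definition _ i := GRing.isLinear.Build L (X i) (dsum M N i) *:%R
  (@rpair_fun i) (@rpair_linear i).
Fact rpair_subproof i q (v : X i) :
  rpair_fun (rmod_str X i (pure q v))
    = rmod_str (dsum M N) i (pure q (rpair_fun v)).
Proof. by rewrite /= tens_liftE /= /rpair_fun !rhom_pure. Qed.
Definition rpair : rhom X (dsum M N) :=
  @Rhom X (dsum M N) (fun i => (@rpair_fun i : {linear X i -> dsum M N i}))
    (rhom_gen rpair_subproof).
End Pair.

(* (f, g) : M ⊕ N -> X *)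
Section Copair.
Variables (f : rhom M X) (g : rhom N X).
Definition rcopair_fun i (x : dsum M N i) : X i := f i x.1 + g i x.2.
Fact rcopair_linear i : linear (@rcopair_fun i).
Proof.
by move=> a x y; rewrite /rcopair_fun /= !linearP scalerDr addrACA.
Qed.
HB.instance Definition _ i := GRing.isLinear.Build L (dsum M N i) (X i) *:%R
  (@rcopair_fun i) (@rcopair_linear i).
Fact rcopair_subproof i q (v : dsum M N i) :
  rcopair_fun (rmod_str (dsum M N) i (pure q v))
    = rmod_str X i (pure q (rcopair_fun v)).
Proof.
by rewrite /= tens_liftE /= /rcopair_fun !rhom_pure pureDr linearD.
Qed.
Definition rcopair : rhom (dsum M N) X :=
  @Rhom (dsum M N) X (fun i => (@rcopair_fun i : {linear dsum M N i -> X i}))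
    (rhom_gen rcopair_subproof).
End Copair.

End Pairing.

Record rsub (M : rmod) := Rsub {
  rsub_comp :> forall i, submodule (M i);
  rsub_str : forall i q (x : M i),
    rsub_comp i x -> rsub_comp (i + 1) (rmod_str M i (pure q x)) }.

Section SubQuotient.
Variables (M : rmod) (N : rsub M).

Definition sub_comp i : lmodType L := sm_type (N i).

Fact sub_str_subproof i q (x : sub_comp i) :
  rmod_str M i (pure q (val x)) \in sm_pred (N (i + 1)).
Proof. by apply/asboolP/rsub_str/asboolP/(valP x). Qed.

Definition sub_bal i : balanced (sub_comp i) (sub_comp (i + 1)).
Proof.
exists (fun q x => SmType (sub_str_subproof q x)).
- by move=> q q' v; apply: val_inj; rewrite /= pureDl linearD.
- by move=> q v v'; apply: val_inj; rewrite /= pureDr linearD.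
- by move=> q a v; apply: val_inj; rewrite /= pure_mid.
- by move=> a q v; apply: val_inj; rewrite /= pure_lact linearZ.
Defined.

Definition sub_str i : {linear tens (sub_comp i) -> sub_comp (i + 1)} :=
  tens_lift (sub_bal i).

Fact sub_fg i : fin_gen (sub_comp i).
Proof. by apply: fin_gen_sub; exact: rmod_fg. Qed.

Fact sub_bounded :
  exists s : seq int, forall i, i \notin s -> forall x : sub_comp i, x = 0.
Proof.
have [s sP] := rmod_bounded M; exists s => i /sP M0 x.
by apply: val_inj; rewrite (M0 (val x)) raddf0.
Qed.

Fact sub_str2 i q q' (v : sub_comp i) :
  sub_str (i + 1) (pure q (sub_str i (pure q' v))) = 0.
Proof.
by apply: val_inj; rewrite /sub_str /= !tens_liftE /= rmod_str2_pure.
Qed.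

Definition sub_rmod : rmod :=
  @Rmod sub_comp sub_str sub_fg sub_bounded (rmod_str2_gen sub_str2).

Definition quo_comp i : lmodType L := sm_quot (N i).

Lemma quo_strE i q (x y : M i) :
  sm_proj (N i) x = sm_proj (N i) y ->
  sm_proj (N (i + 1)) (rmod_str M i (pure q x)) =
  sm_proj (N (i + 1)) (rmod_str M i (pure q y)).
Proof.
move=> /sm_projE Nxy; apply/sm_projE; rewrite -[x](subrK y) pureDr.
by rewrite linearD addrK; exact: rsub_str.
Qed.

Definition quo_bal i : balanced (quo_comp i) (quo_comp (i + 1)).
Proof.
exists (fun q x => sm_proj (N (i + 1)) (rmod_str M i (pure q (repr x)))).
- by move=> q q' v; rewrite pureDl linearD sm_projD.
- move=> q v v'; rewrite -sm_projD -linearD -pureDr; apply: quo_strE.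
  by rewrite sm_projD !sm_projK.
- move=> q a v; rewrite pure_mid; apply: quo_strE.
  by rewrite sm_projZ !sm_projK.
- by move=> a q v; rewrite pure_lact linearZ sm_projZ.
Defined.

Definition quo_str i : {linear tens (quo_comp i) -> quo_comp (i + 1)} :=
  tens_lift (quo_bal i).

Fact quo_fg i : fin_gen (quo_comp i).
Proof. by apply: fin_gen_quot; exact: rmod_fg. Qed.

Fact quo_bounded :
  exists s : seq int, forall i, i \notin s -> forall x : quo_comp i, x = 0.
Proof.
have [s sP] := rmod_bounded M; exists s => i /sP M0 x.
by rewrite -[x]sm_projK (M0 (repr x)) raddf0.
Qed.

Fact quo_str2 i q q' (v : quo_comp i) :
  quo_str (i + 1) (pure q (quo_str i (pure q' v))) = 0.
Proof.
rewrite /quo_str /= !tens_liftE /=.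
rewrite (quo_strE q (sm_projK _)) rmod_str2_pure; exact: raddf0.
Qed.

Definition quo_rmod : rmod :=
  @Rmod quo_comp quo_str quo_fg quo_bounded (rmod_str2_gen quo_str2).

End SubQuotient.

Definition rsub_le (M : rmod) (N N' : rsub M) : Prop :=
  forall i x, N i x -> N' i x.
Definition rsub_full (M : rmod) (N : rsub M) : Prop := forall i x, N i x.
Definition rsub_null (M : rmod) (N : rsub M) : Prop :=
  forall i x, N i x -> x = 0.

Definition rsub_maximal (M : rmod) (N : rsub M) : Prop :=
  ~ rsub_full N /\
  forall N' : rsub M, rsub_le N N' -> rsub_le N' N \/ rsub_full N'.

Definition rsub_simple (M : rmod) (N : rsub M) : Prop :=
  ~ rsub_null N /\
  forall N' : rsub M, rsub_le N' N -> rsub_null N' \/ rsub_le N N'.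

Section Meet.
Variables (M : rmod) (C : rsub M -> Prop).

Definition rmeet_mem i (x : M i) : Prop := forall N, C N -> N i x.
Fact rmeet0 i : rmeet_mem (0 : M i).
Proof. by move=> N _; exact: sm_mem0. Qed.
Fact rmeetP i (a : L) (x y : M i) :
  rmeet_mem x -> rmeet_mem y -> rmeet_mem (a *: x + y).
Proof. by move=> Cx Cy N CN; apply: sm_memP; [exact: Cx | exact: Cy]. Qed.
Fact rmeet_str i q (x : M i) :
  rmeet_mem x -> rmeet_mem (rmod_str M i (pure q x)).
Proof. by move=> Cx N CN; apply/rsub_str/Cx. Qed.

Definition rmeet : rsub M :=
  @Rsub M (fun i => Submodule (@rmeet0 i) (@rmeetP i)) rmeet_str.
End Meet.

Definition rradical (M : rmod) : rsub M := rmeet (@rsub_maximal M).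

(* The sum of the simple submodules, as the smallest submodule containing them. *)
Definition rsocle (M : rmod) : rsub M :=
  rmeet (fun N => forall S : rsub M, rsub_simple S -> rsub_le S N).

Definition rmono (M N : rmod) (f : rhom M N) : Prop :=
  forall i, injective (f i).
Definition repi (M N : rmod) (f : rhom M N) : Prop :=
  forall i y, exists x, f i x = y.

Definition ses (X Y Z : rmod) (a : rhom X Y) (b : rhom Y Z) : Prop :=
  [/\ rmono a, repi b & forall i y, b i y = 0 <-> exists x, a i x = y].

Definition riso (M N : rmod) : Prop :=
  exists (f : rhom M N) (g : rhom N M),
    req (rcomp g f) (rid M) /\ req (rcomp f g) (rid N).

Definition split_mono (M N : rmod) (f : rhom M N) : Prop :=
  exists g : rhom N M, req (rcomp g f) (rid M).
Definition split_epi (M N : rmod) (f : rhom M N) : Prop :=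
  exists g : rhom N M, req (rcomp f g) (rid N).

Definition is_zero (M : rmod) : Prop := forall i (x : M i), x = 0.

Definition indecomposable (M : rmod) : Prop :=
  ~ is_zero M /\ forall X Y, riso M (dsum X Y) -> is_zero X \/ is_zero Y.

Definition projective_rmod (P : rmod) : Prop :=
  forall X Y (e : rhom X Y) (u : rhom P Y), repi e ->
    exists v : rhom P X, req (rcomp e v) u.
Definition injective_rmod (I : rmod) : Prop :=
  forall X Y (m : rhom X Y) (u : rhom X I), rmono m ->
    exists v : rhom Y I, req (rcomp v m) u.

Definition no_projective_summand (M : rmod) : Prop :=
  forall X P, projective_rmod P -> riso M (dsum X P) -> is_zero P.

Definition AR_sequence (X Y Z : rmod) (a : rhom X Y) (b : rhom Y Z) : Prop :=
  [/\ ses a b,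
      ~ split_mono a,
      forall N (v : rhom X N), ~ split_mono v ->
        exists u : rhom Y N, req v (rcomp u a),
      ~ split_epi b
    & forall N (u : rhom N Z), ~ split_epi u ->
        exists v : rhom N Y, req u (rcomp b v)].

Definition factors_projinj (M N : rmod) (f : rhom M N) : Prop :=
  exists P (u : rhom M P) (v : rhom P N),
    [/\ projective_rmod P, injective_rmod P & req f (rcomp v u)].

Definition stable_eq (M N : rmod) (f g : rhom M N) : Prop :=
  factors_projinj (rsubh f g).

Definition stable_iso (M N : rmod) (f : rhom M N) : Prop :=
  exists g : rhom N M,
    stable_eq (rcomp g f) (rid M) /\ stable_eq (rcomp f g) (rid N).

Definition stable_split_epi (M N : rmod) (f : rhom M N) : Prop :=
  exists g : rhom N M, stable_eq (rcomp f g) (rid N).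

Definition stable_zero (M : rmod) : Prop := stable_eq (rid M) (rzero M M).

Definition stable_indecomposable (M : rmod) : Prop :=
  ~ stable_zero M /\
  forall X Y (f : rhom M (dsum X Y)), stable_iso f -> stable_zero X \/ stable_zero Y.

Definition essential (M I : rmod) (m : rhom M I) : Prop :=
  forall N : rsub I, (forall i x, N i (m i x) -> m i x = 0) -> rsub_null N.

Record inj_hull (M : rmod) := InjHull {
  hull : rmod;
  hull_inc : rhom M hull;
  hull_inj : injective_rmod hull;
  hull_ess : essential hull_inc;
  hull_coker : rmod;
  hull_prj : rhom hull hull_coker;
  hull_ses : ses hull_inc hull_prj }.

Definition inj_hulls := forall M : rmod, inj_hull M.

Section Triangulated.
Variable H : inj_hulls.

Definition Om (M : rmod) : rmod := hull_coker (H M).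

(* w represents Ω^-1 of the class of u; such a w exists and is unique up to
   [stable_eq]. *)
Definition Om_mor (M N : rmod) (u : rhom M N) (w : rhom (Om M) (Om N)) : Prop :=
  exists e : rhom (hull (H M)) (hull (H N)),
    req (rcomp e (hull_inc (H M))) (rcomp (hull_inc (H N)) u) /\
    req (rcomp w (hull_prj (H M))) (rcomp (hull_prj (H N)) e).

Definition pushout (A B C D : rmod) (f : rhom A B) (g : rhom A C)
    (c : rhom B D) (d : rhom C D) : Prop :=
  req (rcomp c f) (rcomp d g) /\
  forall T (u : rhom B T) (v : rhom C T), req (rcomp u f) (rcomp v g) ->
    exists w : rhom D T, [/\ req (rcomp w c) u, req (rcomp w d) v &
      forall w' : rhom D T, req (rcomp w' c) u -> req (rcomp w' d) v ->
        req w' w].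

Record triangle := Triangle {
  tri1 : rmod; tri2 : rmod; tri3 : rmod;
  tri12 : rhom tri1 tri2;
  tri23 : rhom tri2 tri3;
  tri31 : rhom tri3 (Om tri1) }.

Definition standard_triangle (T : triangle) : Prop :=
  exists d : rhom (hull (H (tri1 T))) (tri3 T),
    [/\ pushout (tri12 T) (hull_inc (H (tri1 T))) (tri23 T) d,
        req (rcomp (tri31 T) (tri23 T)) (rzero _ _)
      & req (rcomp (tri31 T) d) (hull_prj (H (tri1 T)))].

Definition triangle_iso (T T' : triangle) : Prop :=
  exists (a : rhom (tri1 T) (tri1 T')) (b : rhom (tri2 T) (tri2 T'))
         (c : rhom (tri3 T) (tri3 T')) (w : rhom (Om (tri1 T)) (Om (tri1 T'))),
    [/\ [/\ stable_iso a, stable_iso b & stable_iso c], Om_mor a w,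
        stable_eq (rcomp b (tri12 T)) (rcomp (tri12 T') a),
        stable_eq (rcomp c (tri23 T)) (rcomp (tri23 T') b)
      & stable_eq (rcomp w (tri31 T)) (rcomp (tri31 T') c)].

Definition distinguished (T : triangle) : Prop :=
  exists T', standard_triangle T' /\ triangle_iso T' T.

Definition AR_triangle (T : triangle) : Prop :=
  [/\ distinguished T,
      stable_indecomposable (tri1 T) /\ stable_indecomposable (tri3 T),
      ~ stable_eq (tri31 T) (rzero _ _)
    & forall N (u : rhom N (tri3 T)), ~ stable_split_epi u ->
        exists v : rhom N (tri2 T), stable_eq u (rcomp (tri23 T) v)].

(* The third map t of the triangle of a short exact sequence (a, b): extend
   the hull X -> I to v : Y -> I; then t b = - p v, where p : I -> Ω^-1 X.
   The sign is forced by [standard_triangle]: let (c, d) be the pushout of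
   (a, X -> I) with object C, r : C -> Ω^-1 X the third map of the standard
   triangle on a, and e : C -> Z with e c = b and e d = 0, a stable
   isomorphism.  Then r - t e = p q for q : C -> I with q c = v and q d = id,
   so r and t e agree stably and (a, b, t) is isomorphic to (a, c, r). *)
Definition connecting (X Y Z : rmod) (a : rhom X Y) (b : rhom Y Z)
    (t : rhom Z (Om X)) : Prop :=
  exists v : rhom Y (hull (H X)),
    req (rcomp v a) (hull_inc (H X)) /\
    req (rcomp t b) (ropph (rcomp (hull_prj (H X)) v)).

Definition induces (X Y Z : rmod) (a : rhom X Y) (b : rhom Y Z)
    (T : triangle) : Prop :=
  exists t : rhom Z (Om X), connecting a b t /\ triangle_iso (Triangle a b t) T.

End Triangulated.
End Repetitive.

Section Basic.
Variables (K : fieldType) (L : falgType K).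

Definition idempotent_elt (e : L) : Prop := e * e = e.
Definition orthogonal_elts (e f : L) : Prop := e * f = 0 /\ f * e = 0.

Definition primitive_idempotent (e : L) : Prop :=
  [/\ idempotent_elt e, e <> 0 &
   forall f g, idempotent_elt f -> idempotent_elt g -> orthogonal_elts f g ->
     e = f + g -> f = 0 \/ g = 0].

Section LeftIdeal.
Variable e : L.
Definition left_ideal_mem (x : L^o) : Prop := exists y : L, x = y * e.
Fact left_ideal0 : left_ideal_mem 0.
Proof. by exists 0; rewrite mul0r. Qed.
Fact left_idealP (a : L) (x y : L^o) :
  left_ideal_mem x -> left_ideal_mem y -> left_ideal_mem (a *: x + y).
Proof.
by move=> [u ->] [v ->]; exists (a * u + v); rewrite mulrDl -mulrA.
Qed.
Definition left_ideal : submodule L^o := Submodule left_ideal0 left_idealP.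
End LeftIdeal.

Definition basic : Prop :=
  exists (n : nat) (e : 'I_n -> L),
    [/\ forall i, primitive_idempotent (e i),
        forall i j, i != j -> orthogonal_elts (e i) (e j),
        \sum_i e i = 1
      & forall i j, i != j ->
        ~ exists f : {linear sm_type (left_ideal (e i)) ->
                              sm_type (left_ideal (e j))}, bijective f].

End Basic.

(* Main.v *)
(* A stable isomorphism onto a module without projective summands has a strict
   right inverse, because endomorphisms factoring through a projective are
   nilpotent (Fitting).  So, starting from the sequence A -> B (+) I(A) -> C of
   the standard triangle isomorphic to the given one, pulling back along
   M'' -> C, pushing out along A -> M and splitting M' off the middle term
   gives 0 -> M -> M' (+) P -> M'' -> 0 with first component h.  The lifting
   property of the triangle makes it right almost split, and locality of End(M)
   makes it left almost split.

   Each map M -> P1 and P1 -> M'' with P1 a summand of the middle term that is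
   projective is irreducible.  Factoring it through images and submodules, for
   P nonzero, the image of M contains every proper submodule of P and the
   kernel of P -> M'' is contained in every nonzero one. *)
Require Import Defs.
From mathcomp Require Import all_boot all_order all_algebra all_field.
From mathcomp Require Import boolp.
From HB Require Import structures.
Set Implicit Arguments.
Unset Strict Implicit.
Unset Printing Implicit Defensive.
Import GRing.Theory.
Local Open Scope ring_scope.

Local Notation "g ** f" := (rcomp g f) (at level 40, left associativity).

(** The triangle fixes its maps only up to maps through modules that are projective and injective,
    while the conclusion asks for a strict sequence containing the given representative [h]. The
    error terms are absorbed in three ways: a map into an injective is extended along a
    monomorphism, a map out of a projective is lifted along an epimorphism, and what is left is a
    nilpotent f, removed by inverting id - f. The map [g] is whatever the splitting yields and
    agrees with [h'] only stably.

    A hull is injective by definition, so using it as a stably zero object requires that injectives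
    be projective. For this every module is embedded in a projective one, of which an injective
    module is then a summand. The embedding rests on the copies of Q inside the free modules: a
    K-linear functional on each degree of M amounts to a homomorphism from M to a free module. *)

Lemma linear_ext (R : nzRingType) (V W : lmodType R) (f g : {linear V -> W}) :
  f =1 g -> f = g.
Proof.
move=> /funext fg; case: f g fg => [f [[pf] [sf]]] [g [[pg] [sg]]] /= fg.
subst g; do 2 f_equal; f_equal; exact: Prop_irrelevance.
Qed.

(** * Calculus of homomorphisms, kernels, images and quotients *)

Section Homs.
Variables (K : fieldType) (L : falgType K).
Implicit Types M N P X Y Z : rmod L.

(** Turns [req] into Leibniz equality, so that everything below can be computed by rewriting in the
    additive groups [rhom M N]. *)
Lemma rhom_ext M N (f g : rhom M N) : req f g -> f = g.
Proof.
case: f g => [f pf] [g pg] /= fg.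
have {}fg : f = g.
  by apply: functional_extensionality_dep => i; exact: linear_ext (fg i).
by subst g; congr Rhom; exact: Prop_irrelevance.
Qed.

Lemma rhomE M N (f g : rhom M N) : f = g -> req f g.
Proof. by move=> ->. Qed.

(** Written as f - (- g) to reuse the compatibility proofs of [rsubh] and [ropph]; this is where the
    [opprK] of the pointwise computations comes from. *)
Definition raddh M N (f g : rhom M N) : rhom M N := rsubh f (ropph g).

Fact raddhA M N : associative (@raddh M N).
Proof. by move=> f g h; apply: rhom_ext => i x /=; rewrite !opprK addrA. Qed.
Fact raddhC M N : commutative (@raddh M N).
Proof. by move=> f g; apply: rhom_ext => i x /=; rewrite !opprK addrC. Qed.
Fact radd0h M N : left_id (rzero M N) (@raddh M N).
Proof. by move=> f; apply: rhom_ext => i x /=; rewrite !opprK add0r. Qed.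
Fact raddNh M N : left_inverse (rzero M N) (@ropph _ _ M N) (@raddh M N).
Proof. by move=> f; apply: rhom_ext => i x /=; rewrite opprK addNr. Qed.

HB.instance Definition _ M N := gen_eqMixin (rhom M N).
HB.instance Definition _ M N := gen_choiceMixin (rhom M N).
HB.instance Definition _ M N := GRing.isZmodule.Build (rhom M N)
  (@raddhA M N) (@raddhC M N) (@radd0h M N) (@raddNh M N).

Lemma rsubhE M N (f g : rhom M N) : rsubh f g = f - g.
Proof. by apply: rhom_ext => i x /=; rewrite opprK. Qed.

Lemma rcompA M N P Q (f : rhom P Q) (g : rhom N P) (h : rhom M N) :
  f ** (g ** h) = f ** g ** h.
Proof. exact: rhom_ext. Qed.
Lemma rcomp1h M N (f : rhom M N) : rid N ** f = f.
Proof. exact: rhom_ext. Qed.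
Lemma rcomph1 M N (f : rhom M N) : f ** rid M = f.
Proof. exact: rhom_ext. Qed.
Lemma rcompDl M N P (f g : rhom N P) (h : rhom M N) :
  (f + g) ** h = f ** h + g ** h.
Proof. exact: rhom_ext. Qed.
Lemma rcompDr M N P (f : rhom N P) (g h : rhom M N) :
  f ** (g + h) = f ** g + f ** h.
Proof. by apply: rhom_ext => i x /=; rewrite !opprK raddfD. Qed.
Lemma rcompNl M N P (f : rhom N P) (h : rhom M N) : (- f) ** h = - (f ** h).
Proof. exact: rhom_ext. Qed.
Lemma rcompNr M N P (f : rhom N P) (h : rhom M N) : f ** (- h) = - (f ** h).
Proof. by apply: rhom_ext => i x /=; rewrite raddfN. Qed.
Lemma rcompBl M N P (f g : rhom N P) (h : rhom M N) :
  (f - g) ** h = f ** h - g ** h.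
Proof. by rewrite rcompDl rcompNl. Qed.
Lemma rcompBr M N P (f : rhom N P) (g h : rhom M N) :
  f ** (g - h) = f ** g - f ** h.
Proof. by rewrite rcompDr rcompNr. Qed.
Lemma rcomp0h M N P (h : rhom M N) : (0 : rhom N P) ** h = 0.
Proof. exact: rhom_ext. Qed.
Lemma rcomph0 M N P (f : rhom N P) : f ** (0 : rhom M N) = 0.
Proof. by apply: rhom_ext => i x /=; rewrite raddf0. Qed.

Lemma mk_rhom M N (w : forall i, M i -> N i) :
    (forall i, linear (w i)) ->
    (forall i q v, w (i + 1) (rmod_str M i (pure q v)) = rmod_str N i (pure q (w i v))) ->
  exists f : rhom M N, forall i x, f i x = w i x.
Proof.
move=> wl ws.
pose F i : {linear M i -> N i} :=
  HB.pack (w i) (GRing.isLinear.Build L (M i) (N i) *:%R (w i) (wl i)).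
by exists (@Rhom _ _ M N F (@rhom_gen _ _ M N F ws)).
Qed.

(** Uniqueness forces the values picked by choice to be linear and compatible with the structure
    maps, so a map out of a quotient or into a submodule needs only a relation describing it. *)
Lemma mk_rhom_rel M N (R : forall i, M i -> N i -> Prop) :
    (forall i x, exists y, R i x y) ->
    (forall i x y y', R i x y -> R i x y' -> y = y') ->
    (forall i a x y x' y', R i x y -> R i x' y' -> R i (a *: x + x') (a *: y + y')) ->
    (forall i q x y, R i x y -> R (i + 1) (rmod_str M i (pure q x)) (rmod_str N i (pure q y))) ->
  exists f : rhom M N, forall i x, R i x (f i x).
Proof.
move=> Rt Ru Rl Rs; pose w i x := projT1 (cid (Rt i x)).
have wR i x : R i x (w i x) by rewrite /w; case: cid.
have [|i q v|f fE] := @mk_rhom M N w.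
- by move=> i a x y; apply: Ru (wR _ _) _; apply: Rl.
- by apply: Ru (wR _ _) _; apply: Rs.
by exists f => i x; rewrite fE.
Qed.

Lemma rhom_factor M N T (p : rhom M N) (u : rhom M T) : repi p ->
  (forall i x, p i x = 0 -> u i x = 0) -> exists w : rhom N T, w ** p = u.
Proof.
move=> pE pu.
have [i y|i y t t'|i a y t y' t'|i q y t|f fP] :=
    @mk_rhom_rel N T (fun i y t => exists2 x, p i x = y & u i x = t).
- by have [x <-] := pE i y; exists (u i x), x.
- move=> [x px <-] [x' px' <-]; apply/eqP; rewrite -subr_eq0 -linearB.
  by apply/eqP/pu; rewrite linearB px px' subrr.
- by move=> [x <- <-] [x' <- <-]; exists (a *: x + x'); rewrite linearP.
- move=> [x <- <-]; exists (rmod_str M i (pure q x)); rewrite rhom_pure //.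
exists f; apply: rhom_ext => i x /=.
have [x' px' <-] := fP i (p i x).
by apply/eqP; rewrite -subr_eq0 -linearB; apply/eqP/pu; rewrite linearB px' subrr.
Qed.

Lemma rhom_lift M N T (m : rhom M N) (u : rhom T N) : rmono m ->
  (forall i x, exists y, m i y = u i x) -> exists w : rhom T M, m ** w = u.
Proof.
move=> mI mu.
have [i x|i x t t'|i a x t x' t'|i q x t|f fP] :=
    @mk_rhom_rel T M (fun i x t => m i t = u i x).
- exact: mu.
- by move=> <- /mI ->.
- by move=> mt mt'; rewrite !linearP mt mt'.
- by move=> mt; rewrite !rhom_pure mt.
by exists f; apply: rhom_ext.
Qed.

Lemma repi_cancel M N T (p : rhom M N) (u v : rhom N T) : repi p ->
  u ** p = v ** p -> u = v.
Proof.
by move=> pE /rhomE uv; apply: rhom_ext => i y; have [x <-] := pE i y; exact: uv.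
Qed.
Lemma rmono_cancel M N T (m : rhom M N) (u v : rhom T M) : rmono m ->
  m ** u = m ** v -> u = v.
Proof. by move=> mI /rhomE uv; apply: rhom_ext => i y; apply: mI; exact: uv. Qed.

Definition rinv M N (f : rhom M N) (g : rhom N M) := g ** f = rid M /\ f ** g = rid N.

Lemma rmono0 M N (f : rhom M N) : (forall i x, f i x = 0 -> x = 0) -> rmono f.
Proof.
move=> f0 i x y fxy; apply/eqP; rewrite -subr_eq0; apply/eqP/f0.
by rewrite linearB fxy subrr.
Qed.

Lemma bij_rinv M N (f : rhom M N) : rmono f -> repi f -> exists g, rinv f g.
Proof.
move=> fI fE; have [g gf] := @rhom_lift _ _ _ f (rid N) fI fE.
exists g; split=> //; apply: (rmono_cancel fI).
by rewrite rcompA gf rcomp1h rcomph1.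
Qed.

Lemma retract_mono M N (f : rhom M N) g : g ** f = rid M -> rmono f.
Proof. by move=> /rhomE gf i x y fxy; rewrite -[x]gf -[y]gf /= fxy. Qed.
Lemma retract_epi M N (f : rhom M N) g : f ** g = rid N -> repi f.
Proof. by move=> /rhomE gf i y; exists (g i y); exact: gf. Qed.

Lemma split_monoP M N (f : rhom M N) : split_mono f <-> exists g, g ** f = rid M.
Proof. by split=> -[g /= gf]; exists g; [exact: rhom_ext|rewrite gf]. Qed.
Lemma split_epiP M N (f : rhom M N) : split_epi f <-> exists g, f ** g = rid N.
Proof. by split=> -[g /= gf]; exists g; [exact: rhom_ext|rewrite gf]. Qed.

Lemma riso_rinv M N (f : rhom M N) g : rinv f g -> riso M N.
Proof. by move=> [gf fg]; exists f, g; rewrite gf fg. Qed.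

Lemma risoP M N : riso M N <-> exists (f : rhom M N) g, rinv f g.
Proof.
split=> [[f [g [gf fg]]]|[f [g fg]]]; last exact: riso_rinv fg.
by exists f, g; split; exact: rhom_ext.
Qed.

Definition rinc M (N : rsub M) : rhom (sub_rmod N) M.
Proof.
exists (fun i => (val : {linear sub_rmod N i -> M i})).
by apply: rhom_gen => i q v; rewrite /= tens_liftE.
Defined.

Lemma rinc_mono M (N : rsub M) : rmono (rinc N).
Proof. by move=> i x y; exact: val_inj. Qed.

Lemma rincP M (N : rsub M) i x : N i x <-> exists y, rinc N i y = x.
Proof.
split=> [Nx|[y <-]]; last by have /asboolP := valP y.
have xP : x \in sm_pred (N i) by apply/asboolP.
by exists (SmType xP).
Qed.

Definition rprj M (N : rsub M) : rhom M (quo_rmod N).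
Proof.
exists (fun i => (sm_proj (N i) : {linear M i -> quo_rmod N i})).
apply: rhom_gen => i q v; rewrite /= tens_liftE /=.
by apply: quo_strE; rewrite sm_projK.
Defined.

Lemma rprj_epi M (N : rsub M) : repi (rprj N).
Proof. by move=> i y; exists (repr y); exact: sm_projK. Qed.

Lemma rprjP M (N : rsub M) i x : rprj N i x = 0 <-> N i x.
Proof. by rewrite -[x in N _ x]subr0 -sm_projE /= linear0. Qed.

Lemma rker_subproof M N (f : rhom M N) i (a : L) x y :
  f i x = 0 -> f i y = 0 -> f i (a *: x + y) = 0.
Proof. by move=> fx fy; rewrite linearP /= fx fy scaler0 addr0. Qed.
Definition rker M N (f : rhom M N) : rsub M.
Proof.
exists (fun i => Submodule (linear0 (f i)) (@rker_subproof M N f i)).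
by move=> i q x /= fx; rewrite rhom_pure fx pure0r linear0.
Defined.

Lemma rim0 M N (f : rhom M N) i : exists x, f i x = 0.
Proof. by exists 0; rewrite linear0. Qed.
Lemma rimP M N (f : rhom M N) i (a : L) y y' :
  (exists x, f i x = y) -> (exists x, f i x = y') ->
  exists x, f i x = a *: y + y'.
Proof. by move=> [x <-] [x' <-]; exists (a *: x + x'); rewrite linearP. Qed.
Definition rim M N (f : rhom M N) : rsub N.
Proof.
exists (fun i => Submodule (rim0 f i) (@rimP M N f i)).
by move=> i q x /= [y <-]; exists (rmod_str M i (pure q y)); rewrite rhom_pure.
Defined.

Definition rpreim M N (f : rhom M N) (S : rsub N) : rsub M := rker (rprj S ** f).
Lemma rpreimP M N (f : rhom M N) (S : rsub N) i x :
  rpreim f S i x <-> S i (f i x).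
Proof. exact: rprjP. Qed.

End Homs.

(** * Finite length and Fitting's lemma *)

Section Rank.
Variables (K : fieldType) (L : falgType K).

(** An L-module carries no declared vector space structure over K. Dimensions are therefore taken in
    a finite dimensional space mapped onto it, with K acting through [k%:A]. *)
Lemma fin_gen_cover (V : lmodType L) : fin_gen V ->
  exists (n : nat) (phi : {ffun 'I_n -> L} -> V),
   [/\ forall c d, phi (c + d) = phi c + phi d,
       forall (k : K) c, phi (k *: c) = k%:A *: phi c
     & forall x, exists c, phi c = x].
Proof.
move=> [n [g gP]]; exists n, (fun c => \sum_i c i *: g i); split.
- move=> c d; rewrite -big_split /=; apply: eq_bigr => i _.
  by rewrite ffunE scalerDl.
- move=> k c; rewrite scaler_sumr; apply: eq_bigr => i _.
  by rewrite ffunE scalerA -scalerAl mul1r.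
move=> x; have [c ->] := gP x; exists [ffun i => c i].
by apply: eq_bigr => i _; rewrite ffunE.
Qed.

(* A subspace of maximal dimension among those contained in S is all of S. *)
Lemma vspace_of_pred (E : vectType K) (S : E -> Prop) :
    S 0 -> (forall (k : K) c d, S c -> S d -> S (k *: c + d)) ->
  exists U : {vspace E}, forall c, c \in U <-> S c.
Proof.
move=> S0 SP.
pose ok (d : nat) := `[< exists2 U : {vspace E}, \dim U = d &
  forall c, c \in U -> S c >].
have ok0 : exists d, ok d.
  exists 0%N; apply/asboolP; exists 0%VS; first exact: dimv0.
  by move=> c; rewrite memv0 => /eqP ->.
have ok_le d : ok d -> (d <= \dim {:E})%N.
  by move=> /asboolP[U <- _]; apply/dimvS/subvf.
case: (ex_maxnP ok0 ok_le) => _ /asboolP[U <- US] Umax.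
exists U => c; split; first exact: US.
move=> Sc; pose U' := (U + <[c]>)%VS.
have /Umax leU : ok (\dim U').
  apply/asboolP; exists U' => // _ /memv_addP[u uU [v /vlineP[k ->] ->]].
  by rewrite addrC; apply: SP => //; exact: US.
have /eqP -> : U == U' by rewrite eqEdim addvSl.
by apply: (subvP (addvSr _ _)); exact: memv_line.
Qed.

(** Stands in for length: both chain conditions follow, since an inclusion that does not raise [d]
    can be reversed. *)
Definition strict_rank (T : Type) (le : T -> T -> Prop) (d : T -> nat) :=
  (forall x y, le x y -> d x <= d y)%N /\
  (forall x y, le x y -> d y <= d x -> le y x)%N.

Lemma submodule_rank (V : lmodType L) : fin_gen V ->
  exists d, strict_rank (fun S T : submodule V => forall x, S x -> T x) d.
Proof.
move=> /fin_gen_cover[n [phi [phiD phiZ phiS]]].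
have phi0 : phi 0 = 0 by rewrite -(scale0r 0) phiZ !scale0r.
have UP (S : submodule V) : exists U : {vspace {ffun 'I_n -> L}},
    forall c, c \in U <-> S (phi c).
  apply: (vspace_of_pred (S := fun c => S (phi c))).
    by rewrite phi0; exact: sm_mem0.
  by move=> k c d Sc Sd; rewrite phiD phiZ; exact: sm_memP.
pose U S := projT1 (cid (UP S)).
have UE S c : c \in U S <-> S (phi c) by rewrite /U; case: cid.
have US (S T : submodule V) : (forall x, S x -> T x) -> (U S <= U T)%VS.
  by move=> ST; apply/subvP => c /UE Sc; apply/UE/ST.
exists (fun S => \dim (U S)); split=> S T ST; first exact/dimvS/US.
move=> dTS; have /eqP UU : U S == U T by rewrite eqEdim US.
by move=> x Tx; have [c cx] := phiS x; rewrite -cx -UE UU UE cx.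
Qed.

Lemma rsub_rank (M : rmod L) : exists d, strict_rank (@rsub_le _ _ M) d.
Proof.
have [s sP] := rmod_bounded M.
pose d i := projT1 (cid (submodule_rank (rmod_fg M i))).
have dP i : strict_rank (fun S T : submodule (M i) => forall x, S x -> T x) (d i).
  by rewrite /d; case: cid.
exists (fun N : rsub M => \sum_(i <- s) d i (N i))%N; split=> N N' NN'.
  by apply: leq_sum => i _; apply: (dP i).1; exact: NN'.
move=> dNN' i x N'x.
have [si|/sP M0] := boolP (i \in s); last by rewrite (M0 x); exact: sm_mem0.
apply: (dP i).2 x N'x; first exact: NN'.
(* Degree i is split off both sums. If it grew strictly, so would the total, because no other degree
   shrinks. *)
move: dNN'; rewrite [leqLHS](big_rem i si) [leqRHS](big_rem i si) /=.
move=> dNN'; rewrite leqNgt; apply/negP => lt.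
move: dNN'; rewrite leqNgt -addSn leq_add // leq_sum // => j _.
by apply: (dP j).1; exact: NN'.
Qed.

Implicit Types M N P X Y Z : rmod L.

Lemma strict_rank_min (T : Type) le (d : T -> nat) (P : T -> Prop) x0 : P x0 ->
  strict_rank le d -> exists2 x, P x & forall y, P y -> le y x -> le x y.
Proof.
move=> Px0 [_ dP]; pose ok n := `[< exists2 x, P x & d x = n >].
have ok0 : exists n, ok n by exists (d x0); apply/asboolP; exists x0.
have [_ /asboolP[x Px <-] xmin] := ex_minnP ok0.
exists x => // y Py yx; apply: dP => //; apply: xmin.
by apply/asboolP; exists y.
Qed.

Lemma nat_stationary_decr T le (d : T -> nat) (f : nat -> T) : strict_rank le d ->
  (forall m n, (m <= n)%N -> le (f n) (f m)) ->
  exists m, forall n, (m <= n)%N -> le (f m) (f n).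
Proof.
move=> [_ dP] fle; pose ok n := `[< exists m, d (f m) = n >].
have ok0 : exists n, ok n by exists (d (f 0%N)); apply/asboolP; exists 0%N.
have [_ /asboolP[m <-] mmin] := ex_minnP ok0.
exists m => n mn; apply: dP; first exact: fle.
by apply: mmin; apply/asboolP; exists n.
Qed.

Lemma nat_stationary_incr T le (d : T -> nat) (f : nat -> T) t : strict_rank le d ->
  (forall x, le x t) -> (forall m n, (m <= n)%N -> le (f m) (f n)) ->
  exists m, forall n, (m <= n)%N -> le (f n) (f m).
Proof.
move=> [dm dP] tP fle; pose ok n := `[< exists m, d (f m) = n >].
have ok0 : exists n, ok n by exists (d (f 0%N)); apply/asboolP; exists 0%N.
have ok1 n : ok n -> (n <= d t)%N by move=> /asboolP[m <-]; exact: dm.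
have [_ /asboolP[m <-] mmax] := ex_maxnP ok0 ok1.
exists m => n mn; apply: dP; first exact: fle.
by apply: mmax; apply/asboolP; exists n.
Qed.

Fixpoint rpow M (f : rhom M M) n := if n is m.+1 then f ** rpow f m else rid M.

Lemma rpowD M (f : rhom M M) m n : rpow f (m + n) = rpow f m ** rpow f n.
Proof. by elim: m => [|m IHm]; rewrite /= ?rcomp1h // IHm rcompA. Qed.

Lemma rpowSr M (f : rhom M M) n : rpow f n.+1 = rpow f n ** f.
Proof. by rewrite -addn1 rpowD /= rcomph1. Qed.

Definition nilpotent M (f : rhom M M) := exists n, rpow f n = 0.

(** The witness is the geometric sum 1 + f + ... + f^(n-1). *)
Lemma one_sub_pow M (f : rhom M M) n : exists g,
  (rid M - f) ** g = rid M - rpow f n /\ g ** (rid M - f) = rid M - rpow f n.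
Proof.
elim: n => [|n [g [fg gf]]].
  by exists 0; rewrite rcomp0h rcomph0 /= subrr.
exists (g + rpow f n); split.
  by rewrite rcompDr fg rcompBl rcomp1h addrA subrK.
by rewrite rcompDl gf rcompBr rcomph1 -rpowSr addrA subrK.
Qed.

Lemma one_sub_nilpotent M (f : rhom M M) : nilpotent f ->
  exists g, rinv (rid M - f) g.
Proof.
by move=> [n fn]; have [g [fg gf]] := one_sub_pow f n; exists g; rewrite /rinv fg gf fn subr0.
Qed.

(** Here I is the stable image of the powers of f, and t is the automorphism that f induces on it.
    The last equation says that f^n vanishes on the complement ker r: thus I = 0 means that f is
    nilpotent, and a trivial complement that f is invertible. *)
Lemma fitting X (f : rhom X X) : exists I (u : rhom I X) (r : rhom X I) t n,
  [/\ r ** u = rid I, f ** u = u ** t, exists t', rinv t t' & rpow f n = rpow f n ** u ** r].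
Proof.
have [d dP] := rsub_rank X.
have [|m1 m1P] := nat_stationary_decr (f := fun n => rim (rpow f n)) dP.
  move=> m n /subnKC <- i x /= [y <-]; rewrite rpowD.
  by exists (rpow f (n - m) i y).
have [||m2 m2P] := nat_stationary_incr (f := fun n => rker (rpow f n))
  (t := rker (0 : rhom X X)) dP.
- by move=> N i x _ /=.
- by move=> m n /subnK <- i x /= fx; rewrite rpowD /= fx linear0.
pose N := (m1 + m2)%N; pose g := rpow f N; pose u := rinc (rim g).
have im_stable n i x : exists y, g i x = rpow f n i (g i y).
  have le : (m1 <= N + n)%N by rewrite -addnA leq_addr.
  have [|y yx] := m1P _ le i (g i x).
    by exists (rpow f m2 i x); rewrite /g rpowD.
  by exists y; rewrite -yx addnC rpowD.
have ker_stable n i x : rpow f (N + n) i x = 0 -> g i x = 0.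
  move=> fx; have := @m2P (N + n)%N _ i x fx; rewrite /g rpowD /= => -> //.
    by rewrite linear0.
  by rewrite addnAC leq_addl.
have gf : f ** g = g ** f by rewrite /g -rpowSr.
have [t ut] : exists t, u ** t = f ** u.
  apply: rhom_lift (@rinc_mono _ _ _ _) _ => i y.
  have [x xy] : rim g i (u i y) by apply/rincP; exists y.
  apply: (iffLR (rincP (rim g) _)); exists (f i x).
  by rewrite -[RHS]/(f i (u i y)) -xy; exact: esym (rhomE gf x).
have uI : rmono u by exact: rinc_mono.
have uP i y : exists x, u i y = g i x.
  have [x xy] : rim g i (u i y) by apply/rincP; exists y.
  by exists x.
have [t' tt'] : exists t', rinv t t'.
  apply: bij_rinv.
    apply: (rmono0 (f := t)) => i y ty; apply: uI; rewrite linear0.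
    have [x xy] := uP i y; rewrite xy; apply: (ker_stable 1%N).
    rewrite addn1 rpowSr -gf -[LHS]/(f i (g i x)) -xy.
    by rewrite -[LHS]/((f ** u) i y) -ut -[LHS]/(u i (t i y)) ty linear0.
  move=> i y; have [x xy] := uP i y; have [z xz] := im_stable 1%N i x.
  have /rincP[v vz] : rim g i (g i z) by exists z.
  exists v; apply: uI; rewrite xy xz /= -vz.
  exact: (rhomE ut).
have [p up] : exists p, u ** p = g.
  by apply: rhom_lift uI _ => i x; apply: (iffLR (rincP (rim g) _)); exists x.
(* [p ** u] is the restriction of f^N to I. It is invertible, and its inverse [s] turns [p] into the
   retraction [s ** p] of [u]. *)
have [s ps] : exists s, rinv (p ** u) s.
  apply: bij_rinv.
    apply: (rmono0 (f := p ** u)) => i y py; apply: uI; rewrite linear0.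
    have [x xy] := uP i y; rewrite xy; apply: (ker_stable N).
    rewrite rpowD -/g -[LHS]/(g i (g i x)) -xy -(rhomE up).
    by rewrite -[LHS]/(u i ((p ** u) i y)) py linear0.
  move=> i y; have [x xy] := uP i y; have [z xz] := im_stable N i x.
  have /rincP[v vz] : rim g i (g i z) by exists z.
  exists v; apply: uI; rewrite xy xz /= -vz.
  exact: (rhomE up).
exists _, u, (s ** p), t, N; split; first by rewrite -rcompA ps.1.
- by rewrite ut.
- by exists t'.
have e : u ** p ** u ** (s ** p) = u ** p.
  by rewrite -!rcompA (rcompA p) (rcompA _ s) ps.2 rcomp1h.
by move: e; rewrite up rcompA.
Qed.

End Rank.

(** * Free modules *)

Section FreeModules.
Variables (K : fieldType) (L : falgType K).
Implicit Types M N P X Y Z : rmod L.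

(** A separate name for Q, so that its scalars can be those of L; the scalars of [dual_bimod] are
    those of K. *)
Definition dual_lmod : Type := dual_bimod L.
HB.instance Definition _ := GRing.Zmodule.on dual_lmod.

Fact dual_lactA (a b : L) (x : dual_lmod) :
  dual_lact a (dual_lact b x) = dual_lact (a * b) x.
Proof. by apply/lfunP => y; rewrite !dual_lactE mulrA. Qed.
Fact dual_lact1 : left_id 1 (@dual_lact K L : L -> dual_lmod -> dual_lmod).
Proof. by move=> x; apply/lfunP => y; rewrite dual_lactE mulr1. Qed.
Fact dual_lactDr :
  right_distributive (@dual_lact K L : L -> dual_lmod -> dual_lmod) +%R.
Proof.
move=> a x y; apply/lfunP => z.
by rewrite dual_lactE [LHS]add_lfunE [RHS]add_lfunE !dual_lactE.
Qed.
Fact dual_lactDl (x : dual_lmod) :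
  {morph (fun a => dual_lact a x : dual_lmod) : a b / a + b}.
Proof.
move=> a b; apply/lfunP => z.
by rewrite dual_lactE mulrDr linearD [RHS]add_lfunE !dual_lactE.
Qed.
HB.instance Definition _ := GRing.Zmodule_isLmodule.Build L dual_lmod
  dual_lactA dual_lact1 dual_lactDr dual_lactDl.

Lemma dual_ract0 (q : dual_bimod L) : dual_ract q 0 = 0.
Proof. by apply/lfunP => x; rewrite dual_ractE mul0r linear0 lfunE. Qed.
Lemma dual_ractDl (q q' : dual_bimod L) b :
  dual_ract (q + q') b = dual_ract q b + dual_ract q' b.
Proof. by apply/lfunP => x; rewrite dual_ractE [LHS]add_lfunE [RHS]add_lfunE !dual_ractE. Qed.
Lemma dual_ractDr (q : dual_bimod L) b b' :
  dual_ract q (b + b') = dual_ract q b + dual_ract q b'.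
Proof.
by apply/lfunP => x; rewrite dual_ractE [RHS]add_lfunE !dual_ractE mulrDl linearD.
Qed.

Lemma dual_lactZ (k : K) (q : dual_bimod L) : dual_lact k%:A q = k *: q.
Proof.
apply/lfunP => x; rewrite dual_lactE [RHS]scale_lfunE -scalerAr mulr1.
exact: linearZ.
Qed.

Lemma fin_gen_regular : fin_gen (L^o : lmodType L).
Proof.
exists 1%N, (fun=> 1) => x; exists (fun=> x).
by rewrite big_ord1 [RHS]mulr1.
Qed.

Lemma fin_gen_dual : fin_gen (dual_lmod : lmodType L).
Proof.
pose b := vbasis {: dual_bimod L}.
exists (\dim {: dual_bimod L}), (fun i => b`_i : dual_lmod) => x.
exists (fun i => (coord b i x)%:A); rewrite {1}(coord_vbasis (memvf x)).
by apply: eq_bigr => i _; rewrite -[RHS]/(dual_lact _ _) dual_lactZ.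
Qed.

(* In degree k, the free module on one generator in each degree of s consists of
   a copy of L if k is in s and a copy of Q if k - 1 is in s.  It is cut out of
   the constant module L x Q, which avoids transport along equalities of
   degrees. *)
Section Free.
Variable s : seq int.

Definition free_amb : lmodType L := (L^o * dual_lmod)%type.

Definition free_mem (k : int) (x : free_amb) : Prop :=
  (k \notin s -> x.1 = 0) /\ (k - 1 \notin s -> x.2 = 0).
Fact free_mem0 k : free_mem k 0. Proof. by []. Qed.
Fact free_memP k (a : L) x y :
  free_mem k x -> free_mem k y -> free_mem k (a *: x + y).
Proof.
move=> [x1 x2] [y1 y2]; split=> ks /=.
  by rewrite x1 // y1 // scaler0 addr0.
by rewrite x2 // y2 // scaler0 addr0.
Qed.
Definition free_comp (k : int) : lmodType L :=
  sm_type (Submodule (free_mem0 k) (@free_memP k)).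

(** On the L-part this is the canonical map from Q ⊗ L to Q. The Q-part is sent to 0, since two
    consecutive structure maps must compose to 0. *)
Definition free_act (q : dual_bimod L) (x : free_amb) : free_amb :=
  (0, dual_ract q x.1).

Fact free_act_mem k q (x : free_comp k) :
  free_act q (val x) \in sm_pred (Submodule (free_mem0 (k + 1)) (@free_memP (k + 1))).
Proof.
apply/asboolP; split=> //=; rewrite addrK => ks.
by have /asboolP[-> // _] := valP x; rewrite dual_ract0.
Qed.

Definition free_bal k : balanced (free_comp k) (free_comp (k + 1)).
Proof.
exists (fun q x => SmType (free_act_mem q x)).
- by move=> q q' v; apply: val_inj; rewrite /= /free_act /= dual_ractDl; congr (_, _); rewrite addr0.
- by move=> q v v'; apply: val_inj; rewrite /= /free_act /= dual_ractDr; congr (_, _); rewrite addr0.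
- move=> q a v; apply: val_inj; rewrite /= /free_act /=; congr (_, _).
  by apply/lfunP => x; rewrite !dual_ractE mulrA.
- move=> a q v; apply: val_inj; rewrite /= /free_act /=; congr (_, _).
    by rewrite scaler0.
  by apply/lfunP => x; rewrite dual_ractE !dual_lactE dual_ractE mulrA.
Defined.

Definition free_str k : {linear tens (free_comp k) -> free_comp (k + 1)} :=
  tens_lift (free_bal k).

Fact free_fg k : fin_gen (free_comp k).
Proof. exact/fin_gen_sub/fin_gen_prod/fin_gen_dual/fin_gen_regular. Qed.

Fact free_bounded : exists s' : seq int,
  forall k, k \notin s' -> forall x : free_comp k, x = 0.
Proof.
exists (s ++ [seq j + 1 | j <- s]) => k.
rewrite mem_cat negb_or => /andP[ks k1s] x; apply: val_inj => /=.
have /asboolP[x1 x2] := valP x.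
rewrite [LHS]surjective_pairing x1 // x2 //.
by apply: contra k1s => k1s; apply/mapP; exists (k - 1); rewrite ?subrK.
Qed.

Fact free_str2 k q q' (v : free_comp k) :
  free_str (k + 1) (pure q (free_str k (pure q' v))) = 0.
Proof.
by apply: val_inj; rewrite /free_str /= !tens_liftE /= /free_act /= dual_ract0.
Qed.

Definition free_rmod : rmod L :=
  @Rmod _ _ free_comp free_str free_fg free_bounded (rmod_str2_gen free_str2).

End Free.
End FreeModules.

(** * Maps out of and into free modules *)

Section Frobenius.
Variables (K : fieldType) (L : falgType K).
Implicit Types M N P X Y Z : rmod L.

Section FreeProjective.
Variable s : seq int.

Fact free_gen_subproof k :
  (((k \in s)%:R, 0) : free_amb L) \in
  sm_pred (Submodule (free_mem0 L s k) (@free_memP K L s k)).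
Proof. by apply/asboolP; split=> //= /negPf ->. Qed.
Definition free_gen k : free_rmod L s k := SmType (free_gen_subproof k).

Lemma free_decomp m (x : free_rmod L s (m + 1)) :
  x = (val x).1 *: free_gen (m + 1) + rmod_str (free_rmod L s) m (pure (val x).2 (free_gen m)).
Proof.
apply: val_inj; rewrite /free_rmod /= tens_liftE /= /free_act /=.
have /asboolP[/= x1 x2] := valP x; rewrite addrK in x2.
rewrite [LHS]surjective_pairing; congr (_, _).
  rewrite addr0; case: (boolP (_ \in s)) => [_|/x1 ->]; first exact/esym/mulr1.
  by rewrite [RHS]mul0r.
rewrite -[RHS]/(_ *: (0 : dual_lmod L) + (dual_ract (val x).2 (m \in s)%:R : dual_lmod L)).
rewrite scaler0 add0r; apply/lfunP => y; rewrite dual_ractE.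
by case: (boolP (m \in s)) x2 => [_ _|_ ->] //; rewrite ?mul1r // !lfunE.
Qed.

(** Structure maps land in degrees of the form m + 1; writing every degree in this way avoids
    casts. *)
Lemma int_pred_ex (k : int) : exists m, k = m + 1.
Proof. by exists (k - 1); rewrite subrK. Qed.

Lemma free_ext Y (f g : rhom (free_rmod L s) Y) :
  (forall k, f k (free_gen k) = g k (free_gen k)) -> f = g.
Proof.
move=> fg; apply: rhom_ext => k; have [m ->] := int_pred_ex k => x.
by rewrite (free_decomp x) !linearP /= !rhom_pure !fg.
Qed.

Section FreeHom.
Variables (X : rmod L) (x0 : forall k, X k).

(** The value on the Q-part of degree k is determined by the generator of degree k - 1, which
    requires a cast along k - 1 + 1 = k. In degree m + 1 the cast disappears, because equality
    proofs on integers are unique. *)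
Definition free_tail k (q : dual_bimod L) : X k :=
  @eq_rect int (k - 1 + 1) (fun j => X j) (rmod_str X (k - 1) (pure q (x0 (k - 1)))) k (subrK 1 k).

Lemma free_tailE m q : free_tail (m + 1) q = rmod_str X m (pure q (x0 m)).
Proof.
rewrite /free_tail; move: (subrK 1 (m + 1)); move: (m + 1 - 1) => k e.
have km : k = m := addIr _ e.
by subst k; rewrite (eq_irrelevance e erefl).
Qed.

Lemma free_tailD k q q' : free_tail k (q + q') = free_tail k q + free_tail k q'.
Proof.
by have [m ->] := int_pred_ex k; rewrite !free_tailE pureDl linearD.
Qed.
Lemma free_tailZ k a q : free_tail k (dual_lact a q) = a *: free_tail k q.
Proof.
by have [m ->] := int_pred_ex k; rewrite !free_tailE pure_lact linearZ.
Qed.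

Lemma free_tail_str k q q' : rmod_str X k (pure q (free_tail k q')) = 0.
Proof.
by have [m ->] := int_pred_ex k; rewrite free_tailE rmod_str2_pure.
Qed.

Lemma free_rhom : exists f : rhom (free_rmod L s) X,
  forall k, k \in s -> f k (free_gen k) = x0 k.
Proof.
have tail0 k : free_tail k 0 = 0.
  by apply: (addIr (free_tail k 0)); rewrite -free_tailD !add0r.
have [|k q v|f fE] := @mk_rhom K L (free_rmod L s) X
    (fun k x => (val x).1 *: x0 k + free_tail k (val x).2).
- move=> k a x y /=; rewrite scalerDl scalerDr -scalerA addrACA; congr (_ + _).
  by rewrite free_tailD free_tailZ.
- rewrite /free_rmod /= tens_liftE /= scale0r add0r free_tailE pureDr linearD.
  by rewrite pure_mid free_tail_str addr0.
by exists f => k ks; rewrite fE /= ks scale1r tail0 addr0.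
Qed.

End FreeHom.

Lemma free_projective : projective_rmod (free_rmod L s).
Proof.
move=> X Y e u eE.
pose x0 k : X k := projT1 (cid (eE k (u k (free_gen k)))).
have [v vP] := free_rhom x0; exists v; suff -> : e ** v = u by [].
apply: free_ext => k /=; case: (boolP (k \in s)) => ks.
  by rewrite vP // /x0; case: cid.
have -> : free_gen k = 0 by apply: val_inj; rewrite /= (negPf ks).
by rewrite !linear0.
Qed.

End FreeProjective.

Definition kfunctional (V : lmodType L) (phi : V -> K) :=
  forall (k : K) x y, phi (k%:A *: x + y) = k * phi x + phi y.

(** With p the cover and U its kernel, w projects along U onto a complement. It kills U, so a
    coordinate of w at any preimage is a well-defined functional on V; a nonzero coordinate of w c
    separates x = p c from 0. *)
Lemma kfunctional_sep (V : lmodType L) (x : V) : fin_gen V -> x <> 0 ->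
  exists2 phi, kfunctional phi & phi x <> 0.
Proof.
move=> /fin_gen_cover[n [p [pD pZ pS]]] x0; pose E := {ffun 'I_n -> L}.
have p0 : p 0 = 0 by rewrite -(scale0r 0) pZ !scale0r.
have pB c d : p (c - d) = p c - p d.
  by apply/eqP; rewrite eq_sym subr_eq -pD subrK.
have [|k c d cU dU|U UP] := @vspace_of_pred K {ffun 'I_n -> L} (fun c => p c = 0).
- exact: p0.
- by rewrite pD pZ cU dU scaler0 addr0.
have [c cx] := pS x.
pose w : 'End({ffun 'I_n -> L}) := (\1 - projv U)%VF.
have wE d : w d = d - projv U d by rewrite add_lfunE opp_lfunE id_lfunE.
have wU d : d \in U -> w d = 0 by move=> dU; rewrite wE projv_id // subrr.
have wc : w c != 0.
  apply/eqP => wc; apply: x0; rewrite -cx; apply/UP.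
  by move/eqP: wc; rewrite wE subr_eq0 => /eqP ->; exact: memv_proj.
pose b := vbasis {: {ffun 'I_n -> L}}.
have [i bi] : exists i, coord b i (w c) <> 0.
  apply: contrapT => /forallNP b0; move/eqP: wc; apply.
  rewrite (coord_vbasis (memvf (w c))) big1 // => i _.
  by rewrite (contrapT (b0 i)) scale0r.
pose phi y := coord b i (w (projT1 (cid (pS y)))).
have phiE d : phi (p d) = coord b i (w d).
  rewrite /phi; case: cid => d' /= dd'; congr (coord b i _).
  apply/eqP; rewrite -subr_eq0 -linearB; apply/eqP/wU/UP.
  by rewrite pB dd' subrr.
exists phi => [k y z|]; last by rewrite -cx phiE.
have [d <-] := pS y; have [e <-] := pS z.
by rewrite -pZ -pD !phiE !linearP.
Qed.

(** Reflexivity of a finite dimensional space: x is assembled from the values of F on the dual basis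
    [co]. *)
Lemma dual_reflexive (F : dual_bimod L -> K) :
    (forall k x y, F (k *: x + y) = k * F x + F y) ->
  exists x, forall q : dual_bimod L, q x = F q.
Proof.
move=> FP; pose b := vbasis {: L}.
pose co i : dual_bimod L := linfun (coord b i : L -> K^o).
exists (\sum_(i < \dim {: L}) F (co i) *: b`_i) => q.
have F0 : F 0 = 0.
  by apply: (addrI (F 0)); rewrite -[X in X + _]mul1r -FP scaler0 !addr0.
have qE : q = \sum_(i < \dim {: L}) (q b`_i) *: co i.
  apply/lfunP => x; rewrite {1}(coord_vbasis (memvf x)) linear_sum sum_lfunE.
  apply: eq_bigr => i _; rewrite linearZ scale_lfunE lfunE /=.
  exact: mulrC.
rewrite {2}qE linear_sum.
elim/big_rec2: _ => [//|i x y _ IH].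
by rewrite FP -IH linearZ; congr (_ + _); exact: mulrC.
Qed.

Lemma dual_sep (x : L) : (forall q : dual_bimod L, q x = 0) -> x = 0.
Proof.
move=> x0; rewrite (coord_vbasis (memvf x)) big1 // => i _.
have := x0 (linfun (coord (vbasis {: L}) i : L -> K^o)).
by rewrite lfunE /= => ->; rewrite scale0r.
Qed.

Fact free_act_add (q : dual_bimod L) (a : L) (x y : free_amb L) :
  q (a *: x + y).1 = dual_ract q a x.1 + q y.1.
Proof. by rewrite dual_ractE -linearD. Qed.
Fact dual_lmod_act (a y : L) (x z : free_amb L) :
  (a *: x + z).2 y = x.2 (y * a) + z.2 y.
Proof. by rewrite -dual_lactE [LHS]add_lfunE. Qed.

(* The Q-component of f k x is y |-> phi k (y x); its L-component is the element
   representing the functional q |-> phi (k + 1) (q x) on Q. *)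
Lemma free_cogen M (phi : forall k, M k -> K) : (forall k, kfunctional (@phi k)) ->
  exists s (f : rhom M (free_rmod L s)),
    forall k x, (forall y : L, phi k (y *: x) = (val (f k x)).2 y).
Proof.
move=> phiP.
have phiD k x y : phi k (x + y) = phi k x + phi k y.
  by rewrite -[x in LHS]scale1r -[1]scale1r phiP mul1r.
have phi0 k : phi k 0 = 0.
  by apply: (addrI (phi k 0)); rewrite -phiD !addr0.
have phiZ k (c : K) x : phi k (c%:A *: x) = c * phi k x.
  by rewrite -[_ *: x]addr0 phiP phi0 addr0.
have [t tP] := rmod_bounded M.
(* The copy of Q in degree k belongs to the generator of degree k - 1, hence the support shifted
   down by one. *)
pose s := t ++ [seq j - 1 | j <- t].
have sP k : k \notin s -> forall x : M k, x = 0.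
  by rewrite mem_cat negb_or => /andP[/tP].
have s1P k : k - 1 \notin s -> forall x : M k, x = 0.
  rewrite mem_cat negb_or => /andP[_ ks]; apply: tP.
  by apply: contra ks => kt; apply/mapP; exists k.
pose R k (x : M k) (z : free_rmod L s k) :=
  (forall q : dual_bimod L, q (val z).1 = phi (k + 1) (rmod_str M k (pure q x))) /\
  (forall y : L, phi k (y *: x) = (val z).2 y).
have [k x|k x z z' [z1 z2] [z1' z2']|k a x z x' z' [z1 z2] [z1' z2']|k p x z [z1 z2]|f fP] :=
    @mk_rhom_rel K L M (free_rmod L s) R.
- have Fq c q q' : phi (k + 1) (rmod_str M k (pure (c *: q + q') x)) =
      c * phi (k + 1) (rmod_str M k (pure q x)) + phi (k + 1) (rmod_str M k (pure q' x)).
    by rewrite pureDl -dual_lactZ pure_lact linearP phiP.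
  have [x1 x1P] := dual_reflexive Fq.
  pose F (y : L) : K^o := phi k (y *: x).
  have Fl : linear F.
    move=> c y y'; rewrite /F scalerDl phiD; congr (_ + _).
    by rewrite -[RHS]phiZ scalerA mulr_algl.
  pose F' : {linear L -> K^o} := HB.pack F (GRing.isLinear.Build K L K^o *:%R F Fl).
  have zP : ((x1, linfun F') : free_amb L) \in
  sm_pred (Submodule (free_mem0 L s k) (@free_memP K L s k)).
    apply/asboolP; split=> /= ks.
      by apply: dual_sep => q; rewrite x1P (sP k ks x) pure0r linear0.
    apply/lfunP => y; rewrite (lfunE F') [RHS]zero_lfunE /=.
    by rewrite /F (s1P k ks (y *: x)) phi0.
  by exists (SmType zP); split=> //= y; rewrite (lfunE F').
- apply: val_inj; rewrite [LHS]surjective_pairing [RHS]surjective_pairing.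
  congr (_, _); last by apply/lfunP => y; rewrite -z2 -z2'.
  apply: subr0_eq; apply: dual_sep => q; rewrite linearB /= z1 z1'.
  by rewrite subrr.
- split=> [q|y].
    by rewrite pureDr [X in phi _ X]linearD phiD -pure_mid -z1 -z1' free_act_add.
  by rewrite scalerDr phiD scalerA z2 z2' dual_lmod_act.
- rewrite /R /free_rmod /= tens_liftE; split=> [q|y] /=.
    by rewrite linear0 rmod_str2_pure phi0.
  by rewrite dual_ractE -linearZ -pure_lact -z1 dual_lactE.
by exists s, f => k x y; case: (fP k x).
Qed.

Lemma rmono_eq0 M N (f : rhom M N) i x : rmono f -> f i x = 0 -> x = 0.
Proof. by move=> fI; rewrite -(linear0 (f i)) => /fI. Qed.

End Frobenius.

(** * Projective and injective modules *)

Section ProjectiveInjective.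
Variables (K : fieldType) (L : falgType K).
Implicit Types C M N P Q T X Y Z : rmod L.

Definition rfst M N : rhom (dsum M N) M.
Proof.
exists (fun i => (fst : {linear dsum M N i -> M i})).
by apply: rhom_gen => i q v; rewrite /= tens_liftE.
Defined.
Definition rsnd M N : rhom (dsum M N) N.
Proof.
exists (fun i => (snd : {linear dsum M N i -> N i})).
by apply: rhom_gen => i q v; rewrite /= tens_liftE.
Defined.
Definition rinl M N : rhom M (dsum M N) := rpair (rid M) 0.
Definition rinr M N : rhom N (dsum M N) := rpair 0 (rid N).

Lemma rfst_rpair X M N (f : rhom X M) (g : rhom X N) : rfst M N ** rpair f g = f.
Proof. exact: rhom_ext. Qed.
Lemma rsnd_rpair X M N (f : rhom X M) (g : rhom X N) : rsnd M N ** rpair f g = g.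
Proof. exact: rhom_ext. Qed.
Lemma rpair_eta X M N (e : rhom X (dsum M N)) :
  rpair (rfst M N ** e) (rsnd M N ** e) = e.
Proof. by apply: rhom_ext => i x /=; rewrite /rpair_fun /= -surjective_pairing. Qed.
Lemma rpair_comp T X M N (f : rhom X M) (g : rhom X N) (h : rhom T X) :
  rpair f g ** h = rpair (f ** h) (g ** h).
Proof. exact: rhom_ext. Qed.
Lemma rcopairE M N X (f : rhom M X) (g : rhom N X) :
  rcopair f g = f ** rfst M N + g ** rsnd M N.
Proof. by apply: rhom_ext => i x /=; rewrite opprK. Qed.
Lemma rcopair_rpair T M N X (f : rhom M X) (g : rhom N X) (a : rhom T M) (b : rhom T N) :
  rcopair f g ** rpair a b = f ** a + g ** b.
Proof. by rewrite rcopairE rcompDl -!rcompA rfst_rpair rsnd_rpair. Qed.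
Lemma rcopair_comp M N X T (f : rhom M X) (g : rhom N X) (h : rhom X T) :
  h ** rcopair f g = rcopair (h ** f) (h ** g).
Proof. by rewrite !rcopairE rcompDr !rcompA. Qed.
Lemma rcopair_rinl M N X (f : rhom M X) (g : rhom N X) : rcopair f g ** rinl M N = f.
Proof. by rewrite rcopair_rpair rcomph1 rcomph0 addr0. Qed.
Lemma rcopair_rinr M N X (f : rhom M X) (g : rhom N X) : rcopair f g ** rinr M N = g.
Proof. by rewrite rcopair_rpair rcomph1 rcomph0 add0r. Qed.
Lemma dsum_id M N : rinl M N ** rfst M N + rinr M N ** rsnd M N = rid (dsum M N).
Proof.
apply: rhom_ext => i [x y] /=; rewrite opprK /rpair_fun /=.
by congr (_, _); rewrite ?addr0 ?add0r.
Qed.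

Lemma is_zeroP M : is_zero M <-> rid M = 0.
Proof.
split=> [M0|/rhomE M0 i x]; first by apply: rhom_ext => i x /=; exact: M0.
exact: M0.
Qed.
Lemma to_zero M N (f : rhom M N) : is_zero N -> f = 0.
Proof. by move=> /is_zeroP N0; rewrite -[f]rcomp1h N0 rcomp0h. Qed.

Lemma projective_lift P X Y (e : rhom X Y) (u : rhom P Y) :
  projective_rmod P -> repi e -> exists v, e ** v = u.
Proof. by move=> Pp eE; have [v ev] := Pp _ _ e u eE; exists v; exact: rhom_ext. Qed.
Lemma injective_extend (I : rmod L) X Y (m : rhom X Y) (u : rhom X I) :
  injective_rmod I -> rmono m -> exists v, v ** m = u.
Proof. by move=> Ii mI; have [v vm] := Ii _ _ m u mI; exists v; exact: rhom_ext. Qed.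

Lemma projective_retract P Q (s : rhom P Q) (r : rhom Q P) :
  r ** s = rid P -> projective_rmod Q -> projective_rmod P.
Proof.
move=> rs Qp X Y e u eE; have [v ev] := projective_lift (u ** r) Qp eE.
by exists (v ** s); rewrite rcompA ev -rcompA rs rcomph1.
Qed.
Lemma injective_retract P Q (s : rhom P Q) (r : rhom Q P) :
  r ** s = rid P -> injective_rmod Q -> injective_rmod P.
Proof.
move=> rs Qi X Y m u mI; have [v vm] := injective_extend (s ** u) Qi mI.
by exists (r ** v); rewrite -rcompA vm rcompA rs rcomp1h.
Qed.
Lemma projective_dsum P Q :
  projective_rmod P -> projective_rmod Q -> projective_rmod (dsum P Q).
Proof.
move=> Pp Qp X Y e u eE.
have [v ev] := projective_lift (u ** rinl P Q) Pp eE.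
have [w ew] := projective_lift (u ** rinr P Q) Qp eE.
exists (rcopair v w); rewrite rcopair_comp ev ew rcopairE -!rcompA -rcompDr.
by rewrite dsum_id rcomph1.
Qed.
Lemma injective_dsum P Q :
  injective_rmod P -> injective_rmod Q -> injective_rmod (dsum P Q).
Proof.
move=> Pi Qi X Y m u mI.
have [v vm] := injective_extend (rfst P Q ** u) Pi mI.
have [w wm] := injective_extend (rsnd P Q ** u) Qi mI.
by exists (rpair v w); rewrite rpair_comp vm wm rpair_eta.
Qed.

(** Among the maps from M to projectives, take f with minimal kernel. If the kernel is nonzero, some
    functional is nonzero on it; the map to a free module given by [free_cogen] then cuts the kernel
    down when paired with f, a contradiction. *)
Lemma projective_embedding M : exists P (f : rhom M P), projective_rmod P /\ rmono f.
Proof.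
have [d dP] := rsub_rank M.
pose ok (N : rsub M) := exists P (f : rhom M P), projective_rmod P /\ N = rker f.
have ok0 : ok (rker (0 : rhom M (free_rmod L [::]))).
  by exists (free_rmod L [::]), 0; split=> //; exact: free_projective.
have [_ [P [f [Pp ->]]] fmin] := strict_rank_min ok0 dP.
exists P, f; split=> //; apply: rmono0 => i x fx; apply: contrapT => x0.
(* [free_cogen] takes functionals in all degrees at once; where f is already injective, 0 serves as
   default. *)
have phiP k : exists phi, kfunctional phi /\
    ((exists2 y : M k, f k y = 0 & y <> 0) -> exists2 y : M k, f k y = 0 & phi y <> 0).
  have [[y fy y0]|no] := pselect (exists2 y : M k, f k y = 0 & y <> 0).
    have [phi phiK phiy] := kfunctional_sep (rmod_fg M k) y0.
    by exists phi; split=> // _; exists y.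
  exists (fun=> 0); split=> // c y z; by rewrite mulr0 addr0.
have [s [g gP]] := free_cogen (fun k => (projT2 (cid (phiP k))).1).
have okg : ok (rker (rpair f g)).
  exists (dsum P (free_rmod L s)), (rpair f g); split=> //.
  by apply: projective_dsum => //; exact: free_projective.
have [|y fy phiy] := (projT2 (cid (phiP i))).2; first by exists x.
have {}fmin : (rpair f g) i y = 0.
  by apply: (fmin _ okg) fy => k z [].
apply: phiy; rewrite -[y]scale1r gP.
by case: fmin => _ ->; rewrite zero_lfunE.
Qed.

Lemma injective_projective (I : rmod L) : injective_rmod I -> projective_rmod I.
Proof.
move=> Ii; have [P [f [Pp fI]]] := projective_embedding I.
by have [r rf] := injective_extend (rid I) Ii fI; exact: projective_retract rf Pp.
Qed.

Lemma retract_complement X Y (s : rhom X Y) (r : rhom Y X) : r ** s = rid X ->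
  exists C (c : rhom C Y) (d : rhom Y C),
    [/\ d ** c = rid C, r ** c = 0, d ** s = 0 & s ** r + c ** d = rid Y].
Proof.
move=> rs; pose c := rinc (rker r); have cI : rmono c by exact: rinc_mono.
have rc : r ** c = 0.
  by apply: rhom_ext => i x; apply/(rincP (rker r)); exists x.
have [i x|d cd] := @rhom_lift _ _ _ _ _ c (rid Y - s ** r) cI.
  apply/(rincP (rker r)); rewrite /= opprK linearD linearN /=.
  by rewrite -[r i (s i _)]/((r ** s) i _) rs subrr.
exists (sub_rmod (rker r)), c, d; split=> //; last by rewrite cd addrC subrK.
  apply: (rmono_cancel cI); rewrite rcompA cd rcompBl -rcompA rc.
  by rewrite rcomph0 subr0 rcomp1h rcomph1.
apply: (rmono_cancel cI); rewrite rcompA cd rcompBl -rcompA rs.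
by rewrite rcomph1 rcomp1h subrr rcomph0.
Qed.

Lemma biproduct_riso X Y C (s : rhom X Y) (r : rhom Y X) (c : rhom C Y) (d : rhom Y C) :
    r ** s = rid X -> d ** c = rid C -> r ** c = 0 -> d ** s = 0 ->
    s ** r + c ** d = rid Y ->
  rinv (rpair r d) (rcopair s c).
Proof.
move=> rs dc rc ds sc; split; first by rewrite rcopair_rpair.
rewrite rcopairE rcompDr !rcompA (rpair_comp r d s) (rpair_comp r d c).
by rewrite rs dc rc ds dsum_id.
Qed.

Lemma no_projective_retract M P (s : rhom P M) (r : rhom M P) :
  no_projective_summand M -> r ** s = rid P -> projective_rmod P -> is_zero P.
Proof.
move=> noP rs Pp; have [C [c [d [dc rc ds sc]]]] := retract_complement rs.
apply: (noP C P Pp); apply/risoP; exists (rpair d r), (rcopair c s).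
by apply: biproduct_riso => //; rewrite addrC.
Qed.

(** The stable image I of the powers of v u is a summand of X, and u embeds it as a summand of Z
    because v u is invertible on it. So I is projective and a summand of a module without projective
    summands, hence zero. *)
Lemma factor_nilpotent X Z (u : rhom X Z) (v : rhom Z X) :
    projective_rmod X /\ no_projective_summand Z \/
    projective_rmod Z /\ no_projective_summand X ->
  nilpotent (v ** u).
Proof.
move=> XZ; have [I [s [r [t [n [rs fs [t' [t't tt']] fn]]]]]] := fitting (v ** u).
exists n; rewrite fn; suff I0 : is_zero I by rewrite (to_zero r I0) rcomph0.
have zr : (t' ** r ** v) ** (u ** s) = rid I.
  by rewrite -!rcompA (rcompA v) fs (rcompA r) rs rcomp1h.
case: XZ => [[Xp Zn]|[Zp Xn]].
  exact: no_projective_retract Zn zr (projective_retract rs Xp).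
exact: no_projective_retract Xn rs (projective_retract zr Zp).
Qed.

Lemma indecomposable_endo X (f : rhom X X) : indecomposable X ->
  nilpotent f \/ exists g, rinv f g.
Proof.
move=> [X0 Xind]; have [I [s [r [t [n [rs fs [t' [t't tt']] fn]]]]]] := fitting f.
have [C [c [d [dc rc ds sc]]]] := retract_complement rs.
have [|C0|I0] := Xind C I.
- apply/risoP; exists (rpair d r), (rcopair c s).
  by apply: biproduct_riso => //; rewrite addrC.
- have sr : s ** r = rid X by rewrite -sc (to_zero d C0) rcomph0 addr0.
  right; exists (s ** t' ** r).
  have fE : f = s ** t ** r by rewrite -fs -rcompA sr rcomph1.
  split; rewrite fE.
    by rewrite -!rcompA (rcompA r) rs rcomp1h (rcompA t' t) t't rcomp1h.
  by rewrite -!rcompA (rcompA r) rs rcomp1h (rcompA t t') tt' rcomp1h.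
- by left; exists n; rewrite fn (to_zero r I0) rcomph0.
Qed.

Lemma indecomposable_local X (f g : rhom X X) : indecomposable X ->
  f + g = rid X -> (exists h, rinv f h) \/ (exists h, rinv g h).
Proof.
move=> Xi fg; have [fn|] := indecomposable_endo f Xi; last by left.
right; have -> : g = rid X - f by rewrite -fg addrAC subrr add0r.
exact: one_sub_nilpotent.
Qed.

End ProjectiveInjective.

(** * The stable category *)

Section Stable.
Variables (K : fieldType) (L : falgType K).
Implicit Types A B C M N P Q R T X Y Z : rmod L.

Lemma factors_projinjP M N (f : rhom M N) : factors_projinj f <->
  exists P (u : rhom M P) (v : rhom P N),
    [/\ projective_rmod P, injective_rmod P & f = v ** u].
Proof.
split=> -[P [u [v [Pp Pi fE]]]]; exists P, u, v; split=> //.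
  exact: rhom_ext.
by rewrite fE.
Qed.

Lemma factors_projinj_comp M N P Q (f : rhom N P) (g : rhom P Q) (e : rhom M N) :
  factors_projinj f -> factors_projinj (g ** f ** e).
Proof.
move=> /factors_projinjP[R [u [v [Rp Ri ->]]]]; apply/factors_projinjP.
by exists R, (u ** e), (g ** v); split=> //; rewrite !rcompA.
Qed.

Lemma factors_projinj0 M N : factors_projinj (0 : rhom M N).
Proof.
(* The kernel of an identity serves as the zero module. *)
apply/factors_projinjP; exists (sub_rmod (rker (rid M))), 0, 0.
have z0 : is_zero (sub_rmod (rker (rid M))).
  move=> i x; apply: val_inj; rewrite linear0.
  exact: (iffRL (rincP (rker (rid M)) _) (ex_intro _ x erefl)).
split; last by rewrite rcomp0h.
  by move=> X Y e u _; exists 0 => i x; rewrite (z0 _ x) !linear0.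
by move=> X Y m u _; exists 0 => i x; rewrite (z0 _ (u i x)).
Qed.

Lemma factors_projinjD M N (f g : rhom M N) :
  factors_projinj f -> factors_projinj g -> factors_projinj (f + g).
Proof.
move=> /factors_projinjP[P [u [v [Pp Pi ->]]]].
move=> /factors_projinjP[Q [u' [v' [Qp Qi ->]]]].
apply/factors_projinjP; exists (dsum P Q), (rpair u u'), (rcopair v v'); split.
- exact: projective_dsum.
- exact: injective_dsum.
- by rewrite rcopair_rpair.
Qed.

Lemma factors_projinjN M N (f : rhom M N) :
  factors_projinj f -> factors_projinj (- f).
Proof.
move=> /factors_projinjP[P [u [v [Pp Pi ->]]]]; apply/factors_projinjP.
by exists P, u, (- v); split=> //; rewrite rcompNl.
Qed.

Lemma stable_eqE M N (f g : rhom M N) : stable_eq f g <-> factors_projinj (f - g).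
Proof. by rewrite /stable_eq rsubhE. Qed.

Lemma stable_refl M N (f : rhom M N) : stable_eq f f.
Proof. by apply/stable_eqE; rewrite subrr; exact: factors_projinj0. Qed.
Lemma stable_sym M N (f g : rhom M N) : stable_eq f g -> stable_eq g f.
Proof. by move=> /stable_eqE fg; apply/stable_eqE; rewrite -opprB; exact: factors_projinjN. Qed.
Lemma stable_trans M N (g f h : rhom M N) :
  stable_eq f g -> stable_eq g h -> stable_eq f h.
Proof.
move=> /stable_eqE fg /stable_eqE gh; apply/stable_eqE.
by rewrite -(subrKA g); exact: factors_projinjD.
Qed.
Lemma stable_compl M N P (h : rhom N P) (f g : rhom M N) :
  stable_eq f g -> stable_eq (h ** f) (h ** g).
Proof.
move=> /stable_eqE fg; apply/stable_eqE.
by rewrite -rcompBr -[_ ** _]rcomph1; exact: factors_projinj_comp.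
Qed.
Lemma stable_compr M N P (f g : rhom N P) (h : rhom M N) :
  stable_eq f g -> stable_eq (f ** h) (g ** h).
Proof.
move=> /stable_eqE fg; apply/stable_eqE.
by rewrite -rcompBl -[_ - _]rcomp1h; exact: factors_projinj_comp.
Qed.

Lemma stable_iso_comp M N P (g : rhom N P) (f : rhom M N) :
  stable_iso g -> stable_iso f -> stable_iso (g ** f).
Proof.
move=> [g' [g'g gg']] [f' [f'f ff']]; exists (f' ** g'); split.
  rewrite rcompA -(rcompA f'); apply: stable_trans f'f.
  by have := stable_compr f (stable_compl f' g'g); rewrite rcomph1.
rewrite rcompA -(rcompA g); apply: stable_trans gg'.
by have := stable_compr g' (stable_compl g ff'); rewrite rcomph1.
Qed.

Lemma stable_iso_retract M N (s : rhom M N) (r : rhom N M) :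
  r ** s = rid M -> stable_eq (s ** r) (rid N) -> stable_iso s /\ stable_iso r.
Proof.
move=> rs sr; split; [exists r|exists s]; rewrite rs; split=> //;
  exact: stable_refl.
Qed.

Lemma stable_iso_id M : stable_iso (rid M).
Proof. by exists (rid M); rewrite rcomp1h; split; exact: stable_refl. Qed.

Lemma stable_zeroP M : stable_zero M <-> projective_rmod M /\ injective_rmod M.
Proof.
rewrite /stable_zero; split.
  move=> /stable_eqE; rewrite subr0 => /factors_projinjP[P [u [v [Pp Pi vu]]]].
  by split; [exact: projective_retract (esym vu) Pp|exact: injective_retract (esym vu) Pi].
move=> [Mp Mi]; apply/stable_eqE; rewrite subr0; apply/factors_projinjP.
by exists M, (rid M), (rid M); rewrite rcomp1h.
Qed.

(* Endomorphisms of M that factor through a projective are nilpotent, so a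
   stable one-sided inverse can be corrected to a strict one. *)
Lemma stable_retract_lift X M (f : rhom X M) (g : rhom M X) :
    no_projective_summand M -> stable_eq (f ** g) (rid M) ->
  exists2 g', f ** g' = rid M & stable_eq g' g.
Proof.
move=> Mn fg; have /stable_eqE/factors_projinjP[P [u [v [Pp _ E]]]] := stable_sym fg.
have [|p [p1 p2]] := @one_sub_nilpotent _ _ _ (v ** u).
  by apply: factor_nilpotent; right.
rewrite -E subKr in p1 p2; exists (g ** p); first by rewrite rcompA.
rewrite -[X in stable_eq _ X]rcomph1; apply: stable_compl.
apply: (stable_trans (g := f ** g ** p)); last by rewrite p2; exact: stable_refl.
by have := stable_compr p (stable_sym fg); rewrite rcomp1h.
Qed.

Lemma stable_iso_lift X M (f : rhom X M) : no_projective_summand M ->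
  stable_iso f -> exists2 g, f ** g = rid M & stable_eq (g ** f) (rid X).
Proof.
move=> Mn [g [gf fg]]; have [g' fg' g'g] := stable_retract_lift Mn fg.
by exists g' => //; apply: stable_trans gf; exact: stable_compr.
Qed.

Section ShortExact.
Variables (X Y Z : rmod L) (k : rhom X Y) (l : rhom Y Z).
Hypothesis kl : ses k l.

Lemma ses_mono : rmono k. Proof. by case: kl. Qed.
Lemma ses_epi : repi l. Proof. by case: kl. Qed.
Lemma ses_comp0 : l ** k = 0.
Proof.
by case: kl => _ _ kle; apply: rhom_ext => i x; apply/kle; exists x.
Qed.
Lemma ses_factor T (u : rhom Y T) : u ** k = 0 -> exists w, w ** l = u.
Proof.
move=> /rhomE uk; apply: rhom_factor ses_epi _ => i y.
by case: kl => _ _ kle /kle[x <-]; exact: uk.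
Qed.
Lemma ses_lift T (u : rhom T Y) : l ** u = 0 -> exists w, k ** w = u.
Proof.
move=> /rhomE lu; apply: rhom_lift ses_mono _ => i y.
by case: kl => _ _ kle; apply/kle; exact: lu.
Qed.
End ShortExact.

Lemma ses_of X Y Z (k : rhom X Y) (l : rhom Y Z) : rmono k -> repi l ->
    l ** k = 0 -> (forall i y, l i y = 0 -> exists x, k i x = y) -> ses k l.
Proof.
move=> kI lE /rhomE lk kl; split=> // i y; split; first exact: kl.
by move=> [x <-]; exact: lk.
Qed.

Lemma ses_split X Y Z (k : rhom X Y) (l : rhom Y Z) : ses k l ->
  (exists r, r ** k = rid X) <-> (exists s, l ** s = rid Z).
Proof.
move=> kl; split=> [[r rk]|[s ls]].
  have [|s sl] := ses_factor kl (u := rid Y - k ** r).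
    by rewrite rcompBl -rcompA rk rcomph1 rcomp1h subrr.
  exists s; apply: (repi_cancel (ses_epi kl)); rewrite -rcompA sl.
  by rewrite rcompBr rcompA (ses_comp0 kl) rcomp0h subr0 rcomph1 rcomp1h.
have [|r kr] := ses_lift kl (u := rid Y - s ** l).
  by rewrite rcompBr rcompA ls rcomph1 rcomp1h subrr.
exists r; apply: (rmono_cancel (ses_mono kl)); rewrite rcompA kr.
by rewrite rcompBl -rcompA (ses_comp0 kl) rcomph0 subr0 rcomph1 rcomp1h.
Qed.

Lemma ses_riso X Y Y' Z (k : rhom X Y) (l : rhom Y Z) (p : rhom Y Y') (q : rhom Y' Y) :
  ses k l -> rinv p q -> ses (p ** k) (l ** q).
Proof.
move=> kl [qp pq].
apply: ses_of.
- by move=> i x y /(retract_mono qp)/(ses_mono kl).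
- move=> i z; have [y <-] := ses_epi kl z; exists (p i y).
  by rewrite -[LHS]/(l i ((q ** p) i y)) qp.
- by rewrite rcompA -(rcompA l) qp rcomph1 (ses_comp0 kl).
- case: kl => _ _ kle i y /kle[x kx]; exists x.
  by rewrite -[LHS]/(p i (k i x)) kx -[LHS]/((p ** q) i y) pq.
Qed.

(** A pushout is known only through its universal property, so D is compared with the explicit
    cokernel of (f, m)^t. Uniqueness in the universal property gives w' w = id, which transfers
    exactness from the cokernel to D. *)
Lemma pushout_ses A B C D (f : rhom A B) (m : rhom A C) (c : rhom B D) (d : rhom C D) :
  rmono m -> pushout f m c d -> ses (rpair f m) (rcopair c (- d)).
Proof.
move=> mI [cf po]; have {}cf : c ** f = d ** m by exact: rhom_ext.
pose p := rprj (rim (rpair f m)); pose l := rcopair c (- d).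
have lk : l ** rpair f m = 0 by rewrite rcopair_rpair rcompNl cf subrr.
have pk : p ** rpair f m = 0.
  by apply: rhom_ext => i x; apply/(rprjP (rim (rpair f m))); exists x.
have pE : rcopair (p ** rinl B C) (p ** rinr B C) = p.
  by rewrite -rcopair_comp rcopairE dsum_id rcomph1.
have [|w [wc wd _]] := po _ (p ** rinl B C) (- (p ** rinr B C)).
  rewrite rcompNl; suff -> : p ** rinl B C ** f = - (p ** rinr B C ** m) by [].
  by apply/eqP; rewrite -addr_eq0 -rcopair_rpair pE pk.
have {}wc : w ** c = p ** rinl B C by exact: rhom_ext.
have {}wd : w ** d = - (p ** rinr B C) by exact: rhom_ext.
have wl : w ** l = p by rewrite rcopair_comp rcompNr wc wd opprK pE.
have [i x|w' w'p] := @rhom_factor _ _ _ _ _ p l (@rprj_epi _ _ _ _).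
  by move=> /(rprjP (rim (rpair f m)))[y <-]; exact: (rhomE lk).
have w'w : w' ** w = rid D.
  have [|x [_ _ xU]] := po D c d; first by rewrite cf.
  transitivity x; first apply: rhom_ext; last apply/esym/rhom_ext.
    apply: xU; rewrite -rcompA ?wc ?wd ?rcompNr rcompA w'p ?rcopair_rinl //.
    by rewrite rcopair_rinr opprK.
  by apply: xU; rewrite rcomp1h.
apply: ses_of lk _.
- by move=> i x y [_ /mI].
- move=> i y; have [x xy] := @rprj_epi _ _ _ _ i (w i y); exists x.
  by rewrite -[LHS]/(l i x) -w'p -[RHS](rhomE w'w) /= -xy.
- move=> i y ly; apply/(rprjP (rim (rpair f m))).
  by rewrite -[LHS]/(p i y) -wl -[LHS]/(w i (l i y)) ly linear0.
Qed.

(** The pullback along s is the preimage of im s. The idempotent e = id - s c factors through a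
    projective, so it lifts along l to q with l q = e. Then id - q l maps Y into the preimage and
    retracts j, and q l is stably zero. *)
Lemma ses_pullback X Y Z Z' (k : rhom X Y) (l : rhom Y Z) (c : rhom Z Z') (s : rhom Z' Z) :
    ses k l -> c ** s = rid Z' -> stable_eq (s ** c) (rid Z) ->
  exists Y' (j : rhom Y' Y) (k' : rhom X Y') (l' : rhom Y' Z'),
    [/\ ses k' l', j ** k' = k, l ** j = s ** l' & stable_iso j].
Proof.
move=> kl cs sc.
have /stable_eqE/factors_projinjP[R [u [v [Rp Ri E]]]] := stable_sym sc.
pose e := rid Z - s ** c; have es : e ** s = 0.
  by rewrite rcompBl -rcompA cs rcomph1 rcomp1h subrr.
have ee : e ** e = e by rewrite {2}/e rcompBr rcomph1 rcompA es rcomp0h subr0.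
have [v' lv'] := projective_lift v Rp (ses_epi kl).
(* The trailing [e] gives q s = 0, so that id - q l fixes the preimage of im s. *)
pose q := v' ** u ** e.
have lq : l ** q = e by rewrite !rcompA lv' -E.
pose Y' := rpreim l (rim s); pose j := rinc Y'.
have jI : rmono j by exact: rinc_mono.
have sI := retract_mono cs.
have jlift T (w : rhom T Y) z : l ** w = s ** z -> exists w', j ** w' = w.
  move=> lw; apply: rhom_lift jI _ => i x; apply: (iffLR (rincP Y' _)).
  by apply/rpreimP; exists (z i x); rewrite -[LHS]/((s ** z) i x) -lw.
have [k' jk'] : exists k', j ** k' = k.
  by apply: (jlift _ _ 0); rewrite (ses_comp0 kl) rcomph0.
have [l' sl'] : exists l', s ** l' = l ** j.
  apply: rhom_lift sI _ => i x.
  by have /rpreimP : Y' i (j i x) by apply/rincP; exists x.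
have [j' jj'] : exists j', j ** j' = rid Y - q ** l.
  apply: (jlift _ _ (c ** l)).
  by rewrite rcompBr (rcompA l q) lq rcomph1 rcompBl rcomp1h opprB addrC subrK rcompA.
exists (sub_rmod Y'), j, k', l'; split=> //.
- apply: ses_of.
  + by move=> i x y k'xy; apply: (ses_mono kl); rewrite -jk' /= k'xy.
  + move=> i z; have [y yz] := ses_epi kl (s i z).
    have /rincP[y' y'y] : Y' i y by apply/rpreimP; exists z.
    exists y'; apply: sI; rewrite -yz -y'y -[LHS]/((s ** l') i y').
    by rewrite sl'.
  + apply: (rmono_cancel sI).
    by rewrite rcompA sl' -rcompA jk' (ses_comp0 kl) rcomph0.
  + move=> i y l'y; have : l i (j i y) = 0.
      by rewrite -[LHS]/((l ** j) i y) -sl' /= l'y linear0.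
    case: kl => _ _ kle /kle[x kx]; exists x; apply: jI.
    by rewrite -kx -jk'.
- have j'j : j' ** j = rid _.
    apply: (rmono_cancel jI); rewrite rcompA jj' rcompBl rcomp1h rcomph1.
    by rewrite -rcompA -sl' rcompA -(rcompA _ e) es rcomph0 rcomp0h subr0.
  apply: (stable_iso_retract j'j _).1; rewrite jj'; apply/stable_eqE.
  rewrite addrAC subrr add0r; apply/factors_projinjN/factors_projinjP.
  by exists R, (u ** e ** l), v'; rewrite !rcompA.
Qed.

(** Dual to the pullback: the pushout along a is the quotient of Y by k (im e), where im e = ker a.
    Since e factors through an injective, it extends along k to q with q k = k e, and id - q induces
    a section of the quotient map. The last clause is the gluing property of the pushout, used to
    build maps out of Y'. *)
Lemma ses_pushout X X' Y Z (k : rhom X Y) (l : rhom Y Z) (a : rhom X X') (s : rhom X' X) :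
    ses k l -> a ** s = rid X' -> stable_eq (s ** a) (rid X) ->
  exists Y' (p : rhom Y Y') (k' : rhom X' Y') (l' : rhom Y' Z),
    [/\ ses k' l', k' ** a = p ** k, l' ** p = l, stable_iso p /\ repi p &
     forall T (u : rhom Y T) (v : rhom X' T), u ** k = v ** a ->
       exists w, w ** p = u /\ w ** k' = v].
Proof.
move=> kl as1 sa.
have /stable_eqE/factors_projinjP[R [u [v [Rp Ri E]]]] := stable_sym sa.
pose e := rid X - s ** a; have ae : a ** e = 0.
  by rewrite rcompBr rcompA as1 rcomph1 rcomp1h subrr.
have ee : e ** e = e by rewrite {1}/e rcompBl rcomp1h -rcompA ae rcomph0 subr0.
have [u' u'k] := injective_extend u Ri (ses_mono kl).
pose q := k ** e ** v ** u'.
have qk : q ** k = k ** e by rewrite -rcompA u'k -rcompA -E -/e -rcompA ee.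
pose p := rprj (rim (k ** e)).
have pE : repi p by exact: rprj_epi.
have pke : p ** k ** e = 0.
  by rewrite -rcompA; apply: rhom_ext => i x; apply/(rprjP (rim (k ** e))); exists x.
have pfac T (w : rhom Y T) : w ** k ** e = 0 -> exists w', w' ** p = w.
  move=> wke; apply: rhom_factor pE _ => i y /(rprjP (rim (k ** e)))[x <-].
  exact: (rhomE wke).
have [p' p'p] : exists p', p' ** p = rid Y - q.
  by apply: pfac; rewrite !rcompBl rcomp1h qk -(rcompA k) ee subrr.
have [l' l'p] : exists l', l' ** p = l.
  by apply: pfac; rewrite (ses_comp0 kl) rcomp0h.
pose k' := p ** k ** s.
have k'a : k' ** a = p ** k.
  have -> : k' ** a = p ** k ** (rid X - e) by rewrite subKr !rcompA.
  by rewrite rcompBr rcomph1 pke subr0.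
exists (quo_rmod (rim (k ** e))), p, k', l'; split=> //.
- apply: ses_of.
  + apply: rmono0 => i x /(rprjP (rim (k ** e)))[y kex].
    have /= eyx : e i y = s i x by apply: (ses_mono kl); exact: kex.
    by rewrite -[x](rhomE as1) /= -eyx; exact: (rhomE ae).
  + by move=> i z; have [y <-] := ses_epi kl z; exists (p i y); rewrite -l'p.
  + by rewrite !rcompA l'p (ses_comp0 kl) rcomp0h.
  + move=> i y; have [y' <-] := pE i y.
    rewrite -[l' i _]/((l' ** p) i y') l'p.
    case: kl => _ _ kle /kle[x <-]; exists (a i x).
    by rewrite -[LHS]/((k' ** a) i x) k'a.
- split=> //; have pp' : p ** p' = rid _.
    apply: (repi_cancel pE); rewrite -rcompA p'p rcompBr rcomph1 rcomp1h.
    by rewrite !rcompA pke !rcomp0h subr0.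
  apply: (stable_iso_retract pp' _).2; rewrite p'p; apply/stable_eqE.
  rewrite addrAC subrr add0r; apply/factors_projinjN/factors_projinjP.
  by exists R, u', (k ** e ** v).
- move=> T w z wk; have [|w' w'p] := pfac T w.
    by rewrite wk -rcompA ae rcomph0.
  by exists w'; rewrite !rcompA w'p wk -rcompA as1 rcomph1.
Qed.

End Stable.

(** * From a distinguished triangle to a short exact sequence *)

Section AuslanderReiten.
Variables (K : fieldType) (L : falgType K).
Implicit Types A B C M N P Q R T X Y Z : rmod L.

Section Triangles.
Variable H : inj_hulls L.

Lemma hull_mono M : rmono (hull_inc (H M)).
Proof. exact: ses_mono (hull_ses (H M)). Qed.

Lemma factors_hull M N (u : rhom M (hull (H N))) T (v : rhom (hull (H N)) T) :
  factors_projinj (v ** u).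
Proof.
apply/factors_projinjP; exists _, u, v; split=> //; last exact: hull_inj.
exact/injective_projective/hull_inj.
Qed.

Lemma connectingP X Y Z (k : rhom X Y) (l : rhom Y Z) t : connecting (H := H) k l t <->
  exists v, v ** k = hull_inc (H X) /\ t ** l = - (hull_prj (H X) ** v).
Proof.
split=> -[v [vk tl]]; exists v; first by split; exact: rhom_ext.
by rewrite vk tl.
Qed.

Lemma Om_mor_id M : Om_mor (H := H) (rid M) (rid (Om H M)).
Proof.
by exists (rid _).
Qed.

(* Pull the sequence of the standard triangle back along the third, and push it
   out along the first component of the isomorphism of triangles. *)
Lemma distinguished_ses M M' M''
    (h : rhom M M') (h' : rhom M' M'') (h'' : rhom M'' (Om H M)) :
    distinguished (Triangle h h' h'') ->
    no_projective_summand M -> no_projective_summand M'' ->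
  exists Y (k : rhom M Y) (l : rhom Y M'') (b : rhom Y M') (t : rhom M'' (Om H M)),
    [/\ ses k l, connecting k l t, stable_iso b,
        stable_eq (b ** k) h /\ stable_eq (h' ** b) l & stable_eq t h''].
Proof.
move=> [[A B C f c0 r] [[d [/= po rc rd]]]].
move=> [a [b [c [w [[/= ai bi ci] [e [ei we]] bf cc wr]]]]] Mn M''n.
have {}rc : r ** c0 = 0 by exact: rhom_ext.
have {}rd : r ** d = hull_prj (H A) by exact: rhom_ext.
have {}ei : e ** hull_inc (H A) = hull_inc (H M) ** a by exact: rhom_ext.
have {}we : w ** hull_prj (H A) = hull_prj (H M) ** e by exact: rhom_ext.
have [a1 aa1 a1a] := stable_iso_lift Mn ai.
have [c1 cc1 c1c] := stable_iso_lift M''n ci.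
pose I := hull (H A); pose i := hull_inc (H A).
have kl := pushout_ses (@hull_mono A) po.
pose k := rpair f i; pose l := rcopair c0 (- d).
have b1i : stable_iso (b ** rfst B I).
  apply: (stable_iso_comp bi); apply: (stable_iso_retract (s := rinl B I) _ _).2.
    by rewrite rfst_rpair.
  apply/stable_eqE; rewrite -dsum_id opprD addNKr.
  exact/factors_projinjN/factors_hull.
have [Y0 [j [k0 [l0 [kl0 jk0 lj ji]]]]] := ses_pullback kl cc1 c1c.
have [Y [p [k1 [l1 [kl1 k1a l1p [pi pE] up]]]]] := ses_pushout kl0 aa1 a1a.
have [p' [p'p pp']] := pi.
pose b0 := b ** rfst B I ** j.
have b0i : stable_iso b0 by exact: stable_iso_comp.
have b0k0 : stable_eq (b0 ** k0) (h ** a).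
  by rewrite -rcompA jk0 -rcompA rfst_rpair.
have b0l0 : stable_eq (h' ** b0) l0.
  have -> : l0 = c ** l ** j by rewrite -rcompA lj rcompA cc1 rcomp1h.
  rewrite rcompA; apply: stable_compr; rewrite rcopair_comp rcopairE.
  apply: (stable_trans (g := c ** c0 ** rfst B I)).
    by rewrite rcompA; apply/stable_compr/stable_sym.
  apply/stable_eqE; rewrite opprD addNKr.
  exact/factors_projinjN/factors_hull.
(* [v1] is the extension of the hull of M over Y that [connecting] asks for, glued from the
   coordinate in I(A). The minus sign required there is the one in front of [d] in [l]. *)
have [v1 [v1p v1k1]] : exists v1, v1 ** p = e ** rsnd B I ** j /\ v1 ** k1 = hull_inc (H M).
  by apply: up; rewrite -!rcompA jk0 rsnd_rpair.
exists Y, k1, l1, (b0 ** p'), (w ** r ** c1); split=> //.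
- apply/connectingP; exists v1; split=> //; apply: (repi_cancel pE).
  rewrite rcompNl -(rcompA _ v1) v1p -(rcompA _ l1) l1p -!rcompA -lj.
  rewrite (rcompA r) rcopair_comp rc rcompNr rd rcopairE rcomp0h add0r.
  by rewrite rcompNl rcompNl rcompNr !rcompA we.
- by apply: stable_iso_comp => //; exists p.
- split.
    have -> : k1 = p ** k0 ** a1 by rewrite -k1a -rcompA aa1 rcomph1.
    rewrite !rcompA -(rcompA b0).
    apply: (stable_trans (g := b0 ** k0 ** a1)).
      do 2 apply: stable_compr.
      by have := stable_compl b0 p'p; rewrite rcomph1.
    by have := stable_compr a1 b0k0; rewrite -(rcompA h) aa1 rcomph1.
  rewrite rcompA; apply: (stable_trans (stable_compr p' b0l0)).
  rewrite -l1p -rcompA.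
  by have := stable_compl l1 pp'; rewrite rcomph1.
have := stable_compr c1 wr; rewrite -(rcompA h'') cc1 rcomph1; exact.
Qed.

(** The difference b k - h factors through an injective, hence extends over the monomorphism k;
    subtracting the extension from b gives b1 with b1 k equal to h. A strict section of b1 then
    splits off M'. *)
Lemma distinguished_ses_pair M M' M''
    (h : rhom M M') (h' : rhom M' M'') (h'' : rhom M'' (Om H M)) :
    distinguished (Triangle h h' h'') -> no_projective_summand M ->
    no_projective_summand M' -> no_projective_summand M'' ->
  exists P (alpha : rhom M P) (g : rhom M' M'') (beta : rhom P M'')
         (t : rhom M'' (Om H M)),
    [/\ projective_rmod P /\ injective_rmod P,
        ses (rpair h alpha) (rcopair g beta),
        connecting (rpair h alpha) (rcopair g beta) t,
        stable_eq (h' ** rfst M' P) (rcopair g beta) & stable_eq t h''].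
Proof.
move=> hT Mn M'n M''n.
have [Y [k [l [b [t [kl klt bi [bk h'b] tE]]]]]] := distinguished_ses hT Mn M''n.
have /stable_eqE/factors_projinjP[R [u [v [Rp Ri E]]]] := bk.
have [u' u'k] := injective_extend u Ri (ses_mono kl).
pose b1 := b - v ** u'.
have b1b : stable_eq b1 b.
  apply/stable_eqE; rewrite addrAC subrr add0r; apply/factors_projinjN.
  by apply/factors_projinjP; exists R, u', v.
have b1k : b1 ** k = h by rewrite rcompBl -rcompA u'k -E subKr.
have b1i : stable_iso b1.
  have [b' [b'b bb']] := bi; exists b'; split.
    exact: stable_trans (stable_compl b' b1b) b'b.
  exact: stable_trans (stable_compr b' b1b) bb'.
have [s b1s sb1] := stable_iso_lift M'n b1i.
have [P [c [d [dc b1c ds sc]]]] := retract_complement b1s.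
have inv := biproduct_riso b1s dc b1c ds sc.
(* The complement P is stably zero: its identity factors through id - s b1, which is stably zero. *)
have Ppi : projective_rmod P /\ injective_rmod P.
  apply/stable_zeroP/stable_eqE; rewrite subr0.
  have -> : rid P = d ** (rid Y - s ** b1) ** c.
    by rewrite -sc [s ** _ + _]addrC addrK rcompA dc rcomp1h dc.
  apply: factors_projinj_comp; apply: (iffLR (stable_eqE _ _)).
  exact: stable_sym.
have := ses_riso kl inv; rewrite rpair_comp b1k rcopair_comp => skl.
exists P, (d ** k), (l ** s), (l ** c), t; split=> //.
- have /connectingP[w [wk tl]] := klt; apply/connectingP.
  exists (w ** rcopair s c); split.
    by rewrite -b1k -rpair_comp -rcompA (rcompA _ _ k) inv.1 rcomp1h.
  by rewrite -rcopair_comp !rcompA tl rcompNl.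
- rewrite -rcopair_comp.
  have -> : rfst M' P = b1 ** rcopair s c.
    by rewrite rcopair_comp b1s b1c rcopairE rcomp1h rcomp0h addr0.
  rewrite rcompA; apply: stable_compr.
  exact: stable_trans (stable_compl h' b1b) h'b.
Qed.

End Triangles.

End AuslanderReiten.

(** * Almost split sequences *)

Section AlmostSplit.
Variables (K : fieldType) (L : falgType K).
Implicit Types A B C M N P Q R T X Y Z : rmod L.

Lemma stable_indecomposable_strict M : no_projective_summand M ->
  stable_indecomposable M -> indecomposable M.
Proof.
move=> Mn [M0 Mi]; split.
  move=> /is_zeroP M1; apply: M0; rewrite /stable_zero M1.
  exact: stable_refl.
move=> X Y /risoP[f [g [gf fg]]].
have [|/stable_zeroP[Xp _]|/stable_zeroP[Yp _]] := Mi X Y f.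
- by exists g; rewrite gf fg; split; exact: stable_refl.
- left; apply: (no_projective_retract (s := g ** rinl X Y) (r := rfst X Y ** f) Mn _ Xp).
  by rewrite -rcompA (rcompA f) fg rcomp1h rfst_rpair.
- right; apply: (no_projective_retract (s := g ** rinr X Y) (r := rsnd X Y ** f) Mn _ Yp).
  by rewrite -rcompA (rcompA f) fg rcomp1h rsnd_rpair.
Qed.

(* Given v, push (a, b) out along v.  If the new sequence splits, v factors
   through a; otherwise its epimorphism lifts along b, and the induced
   endomorphism of X is invertible (so v splits) or nilpotent (so b splits). *)
Lemma left_almost_split X Y Z (a : rhom X Y) (b : rhom Y Z) :
    ses a b -> indecomposable X -> ~ split_epi b ->
    (forall N (u : rhom N Z), ~ split_epi u -> exists v, req u (b ** v)) ->
  forall N (v : rhom X N), ~ split_mono v -> exists u, req v (u ** a).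
Proof.
move=> ab Xi bn bras N v vn.
pose e := rpair a v; pose p := rprj (rim e).
have pE : repi p by exact: rprj_epi.
have pe : p ** e = 0.
  by apply: rhom_ext => i x; apply/(rprjP (rim e)); exists x.
have pav : p ** rinl Y N ** a = - (p ** rinr Y N ** v).
  apply/eqP; rewrite -addr_eq0 -rcopair_rpair -rcopair_comp rcopairE dsum_id.
  by rewrite rcomph1 pe.
have [i x|q qp] := @rhom_factor _ _ _ _ _ p (b ** rfst Y N) pE.
  by move=> /(rprjP (rim e))[y <-]; exact: (rhomE (ses_comp0 ab)).
have nE : ses (p ** rinr Y N) q.
  apply: ses_of.
  - apply: rmono0 => i n /(rprjP (rim e))[x [ax <-]].
    by rewrite (rmono_eq0 (ses_mono ab) ax) linear0.
  - move=> i z; have [y <-] := ses_epi ab z; exists (p i (y, 0)).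
    exact: (rhomE qp).
  - by rewrite rcompA qp -rcompA rfst_rpair rcomph0.
  - move=> i w; have [[y n] <-] := pE i w; rewrite -[q i _]/((q ** p) i _) qp /=.
    case: ab => _ _ abE /abE[x ax]; exists (n - v i x).
    apply/eqP; rewrite -subr_eq0 -[_ - _]/(p i _ - p i _) -linearB; apply/eqP.
    apply/(rprjP (rim e)); exists (- x); rewrite linearN /= /rpair_fun ax.
    by congr (_, _); rewrite /= ?sub0r // addrAC subrr add0r.
have [/split_epiP[s qs]|qn] := pselect (split_epi q).
  have [|u uE] := ses_lift nE (u := p ** rinl Y N - s ** b).
    by rewrite rcompBr !rcompA qs qp rcomp1h -rcompA rfst_rpair rcomph1 subrr.
  exists (- u); suff -> : v = - u ** a by [].
  apply: (rmono_cancel (ses_mono nE)).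
  rewrite rcompNl rcompNr rcompA uE rcompBl pav -(rcompA s) (ses_comp0 ab).
  by rewrite rcomph0 subr0 opprK.
have [w /rhom_ext qbw] := bras _ q qn.
(* An endomorphism of Y over Z that restricts along a to - z v. If z v is nilpotent, some power of f
   kills a and so factors through b, which yields a section of b. *)
pose f := w ** p ** rinl Y N.
have bf : b ** f = b.
  by rewrite !rcompA -qbw qp -rcompA rfst_rpair rcomph1.
have [|z az] := ses_lift ab (u := w ** p ** rinr Y N).
  by rewrite !rcompA -qbw qp -rcompA rfst_rpair rcomph0.
have fa : f ** a = a ** (- (z ** v)).
  by rewrite -!rcompA (rcompA p) pav !rcompNr !rcompA az.
have [[n zvn]|[g [gzv _]]] := indecomposable_endo (- (z ** v)) Xi; last first.
  case: vn; apply/split_monoP; exists (- (g ** z)).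
  by rewrite rcompNl -rcompA -rcompNr.
have fna : rpow f n ** a = 0.
  suff -> : rpow f n ** a = a ** rpow (- (z ** v)) n by rewrite zvn rcomph0.
  elim: n {zvn} => [|n IHn]; first by rewrite /= rcomp1h rcomph1.
  by rewrite /= -rcompA IHn rcompA fa rcompA.
have bfn : b ** rpow f n = b.
  elim: n {zvn fna} => [|n IHn]; first by rewrite rcomph1.
  by rewrite /= rcompA bf.
have [s sb] := ses_factor ab fna.
case: bn; apply/split_epiP; exists s; apply: (repi_cancel (ses_epi ab)).
by rewrite -rcompA sb bfn rcomp1h.
Qed.

(** The projection of A ⊕ B onto A extends to an endomorphism f of P that fixes u and kills v. If f
    is nilpotent then u = 0; if f is invertible then v = 0. *)
Lemma injective_uniform P A B (u : rhom A P) (v : rhom B P) :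
    injective_rmod P -> indecomposable P -> rmono (rcopair u v) ->
  is_zero A \/ is_zero B.
Proof.
move=> Pi Pind uvI; have [f fE] := injective_extend (u ** rfst A B) Pi uvI.
have fu : f ** u = u.
  by rewrite -{1}[u](rcopair_rinl u v) rcompA fE -rcompA rfst_rpair rcomph1.
have fv : f ** v = 0.
  by rewrite -{1}[v](rcopair_rinr u v) rcompA fE -rcompA rfst_rpair rcomph0.
have [[n fn]|[g [gf _]]] := indecomposable_endo f Pind.
  left; have u0 : u = 0.
    transitivity (rpow f n ** u); last by rewrite fn rcomp0h.
    elim: n {fn} => [|n IHn]; first by rewrite rcomp1h.
    by rewrite /= -rcompA -IHn fu.
  apply/is_zeroP/(@rmono_cancel _ _ _ _ _ (rcopair u v ** rinl A B)).
    by move=> i x y /uvI [].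
  by rewrite rcopair_rinl u0 !rcomp0h.
right; have v0 : v = 0 by rewrite -[v]rcomp1h -gf -rcompA fv rcomph0.
apply/is_zeroP/(@rmono_cancel _ _ _ _ _ (rcopair u v ** rinr A B)).
  by move=> i x y /uvI [].
by rewrite rcopair_rinr v0 !rcomp0h.
Qed.

(** Dual: the endomorphism f lifts the projection onto A, so that u f = u and v f = 0. *)
Lemma projective_local P A B (u : rhom P A) (v : rhom P B) :
    projective_rmod P -> indecomposable P -> repi (rpair u v) ->
  is_zero A \/ is_zero B.
Proof.
move=> Pp Pind uvE; have [f fE] := projective_lift (rinl A B ** u) Pp uvE.
have fu : u ** f = u.
  by rewrite -{1}[u](rfst_rpair u v) -rcompA fE rcompA rfst_rpair rcomp1h.
have fv : v ** f = 0.
  by rewrite -{1}[v](rsnd_rpair u v) -rcompA fE rcompA rsnd_rpair rcomp0h.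
have [[n fn]|[g [_ fg]]] := indecomposable_endo f Pind.
  left; have u0 : u = 0.
    transitivity (u ** rpow f n); last by rewrite fn rcomph0.
    elim: n {fn} => [|n IHn]; first by rewrite rcomph1.
    by rewrite /= rcompA fu.
  apply/is_zeroP/(@repi_cancel _ _ _ _ _ u); last by rewrite u0 !rcomph0.
  by move=> i x; have [y [<- _]] := uvE i (x, 0); exists y.
right; have v0 : v = 0 by rewrite -[v]rcomph1 -fg rcompA fv rcomp0h.
apply/is_zeroP/(@repi_cancel _ _ _ _ _ v); last by rewrite v0 !rcomph0.
by move=> i x; have [y [_ <-]] := uvE i (0, x); exists y.
Qed.

(** * The projective part of the middle term *)

Section ProjectivePart.
Variables (X Y Z : rmod L) (a : rhom X Y) (b : rhom Y Z).
Hypotheses (AR : AR_sequence a b).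
Hypotheses (Xn : no_projective_summand X) (Zn : no_projective_summand Z).

(** If s does not split, then s = u a, so p - t u kills a and equals w b for some w. On P this reads
    id - w b q = t u q. The map w b q is nilpotent because it factors through Z, which has no
    projective summands; hence t u q is invertible and t splits. *)
Lemma ar_irreducible_left P N (p : rhom Y P) (q : rhom P Y) (s : rhom X N) (t : rhom N P) :
    p ** q = rid P -> projective_rmod P -> p ** a = t ** s ->
  split_mono s \/ split_epi t.
Proof.
move=> pq Pp pa; case: AR => ab _ las _ _.
have [sm|sn] := pselect (split_mono s); [by left|right].
have [u /rhom_ext sE] := las _ s sn.
have [|w wE] := ses_factor ab (u := p - t ** u).
  by rewrite rcompBl pa sE rcompA subrr.
have [|g [_ gE]] := @one_sub_nilpotent _ _ P (w ** (b ** q)).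
  by apply: factor_nilpotent; left.
apply/split_epiP; exists (u ** q ** g).
by rewrite -gE !rcompA wE !rcompBl pq subKr.
Qed.

Lemma ar_irreducible_right P N (p : rhom Y P) (q : rhom P Y) (s : rhom P N) (t : rhom N Z) :
    p ** q = rid P -> projective_rmod P -> b ** q = t ** s ->
  split_mono s \/ split_epi t.
Proof.
move=> pq Pp bq; case: AR => ab _ _ _ ras.
have [te|tn] := pselect (split_epi t); [by right|left].
have [v /rhom_ext tE] := ras _ t tn.
have [|w wE] := ses_lift ab (u := q - v ** s).
  by rewrite rcompBr bq tE rcompA subrr.
have [|g [gE _]] := @one_sub_nilpotent _ _ P (p ** a ** w).
  by apply: factor_nilpotent; left.
apply/split_monoP; exists (g ** p ** v).
by rewrite -gE -!rcompA wE !rcompBr pq subKr.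
Qed.

Section Component.
Variables (P : rmod L) (p : rhom Y P) (q : rhom P Y).
Hypotheses (pq : p ** q = rid P) (P0 : ~ is_zero P).
Hypotheses (Pp : projective_rmod P) (Pi : injective_rmod P).

Lemma ar_left_not_epi : ~ repi (p ** a).
Proof.
move=> pE; have [s ps] := projective_lift (rid P) Pp pE.
exact: P0 (no_projective_retract Xn ps Pp).
Qed.

Lemma ar_right_not_mono : ~ rmono (b ** q).
Proof.
move=> qI; have [r rq] := injective_extend (rid P) Pi qI.
exact: P0 (no_projective_retract Zn rq Pp).
Qed.

Lemma ar_left_mono : rmono (p ** a).
Proof.
have [i x|s sE] := @rhom_lift _ _ _ _ _ (rinc (rim (p ** a))) (p ** a) (@rinc_mono _ _ _ _).
  by apply: (iffLR (rincP (rim (p ** a)) _)); exists x.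
have [/split_monoP[r rs]|/split_epiP[r ir]] := ar_irreducible_left pq Pp (esym sE).
  rewrite -sE => i x y /(@rinc_mono _ _ _ _ i); exact: retract_mono rs i x y.
case: ar_left_not_epi => i y.
have [x <-] := retract_epi ir y.
by have := iffRL (rincP (rim (p ** a)) _) (ex_intro _ x erefl).
Qed.

Lemma ar_right_epi : repi (b ** q).
Proof.
have [i x /(rprjP (rker (b ** q))) //|t tE] :=
  @rhom_factor _ _ _ _ _ (rprj (rker (b ** q))) (b ** q) (@rprj_epi _ _ _ _).
have [/split_monoP[r rs]|/split_epiP[r tr]] := ar_irreducible_right pq Pp (esym tE).
  case: ar_right_not_mono; apply: rmono0 => i x bqx.
  by apply: (rmono_eq0 (retract_mono rs)); apply/(rprjP (rker (b ** q))).
rewrite -tE => i z; have [y <-] := retract_epi tr z.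
by have [x <-] := @rprj_epi _ _ _ (rker (b ** q)) i y; exists x.
Qed.

End Component.

Section Indecomposable.
Variables (P : rmod L) (p : rhom Y P) (q : rhom P Y).
Hypotheses (pq : p ** q = rid P) (P0 : ~ is_zero P).
Hypotheses (Pp : projective_rmod P) (Pi : injective_rmod P).
Hypotheses (X0 : ~ is_zero X) (Z0 : ~ is_zero Z).

(** Let P = P1 ⊕ P2 with P1 nonzero. The component X -> P1 is mono and P2 is injective, so X -> P
    factors as X -> P1 followed by (id, u)^t. If the first map splits, X is projective and thus
    zero; otherwise (id, u)^t is onto, which forces P2 = 0. *)
Lemma ar_projective_indecomposable : indecomposable P.
Proof.
split=> // P1 P2 /risoP[f [g [gf fg]]].
have [|P10] := pselect (is_zero P1); [by left|right].
have r1 : rfst P1 P2 ** f ** (g ** rinl P1 P2) = rid P1.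
  by rewrite -rcompA (rcompA f) fg rcomp1h rfst_rpair.
have P1p := projective_retract r1 Pp; have P1i := injective_retract r1 Pi.
have pq1 : rfst P1 P2 ** f ** p ** (q ** g ** rinl P1 P2) = rid P1.
  by rewrite -!rcompA (rcompA p) pq rcomp1h rcompA.
have aI := ar_left_mono pq1 P10 P1p.
have [u uE] : exists u, u ** (rfst P1 P2 ** f ** p ** a) = rsnd P1 P2 ** f ** p ** a.
  apply: injective_extend aI.
  have r2 : rsnd P1 P2 ** f ** (g ** rinr P1 P2) = rid P2.
    by rewrite -rcompA (rcompA f) fg rcomp1h rsnd_rpair.
  exact: injective_retract r2 Pi.
have fpqg : f ** p ** (q ** g) = rid _.
  by rewrite -!rcompA (rcompA p) pq rcomp1h.
have [||/split_monoP[r rs]|/split_epiP[s us]] := ar_irreducible_left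
    (s := rfst P1 P2 ** f ** p ** a) (t := rpair (rid P1) u) fpqg _ _.
- exact: projective_retract fg Pp.
- by rewrite rpair_comp uE rcomp1h -!rcompA rpair_eta.
- case: X0; apply: no_projective_retract Xn (rcomp1h (rid X)) _.
  exact: projective_retract rs P1p.
move=> i y; have [x [-> <-]] := retract_epi us (0, y).
exact: linear0.
Qed.

Let Pind := ar_projective_indecomposable.

(** The sum of im (p a) and N is proper, because End(P) is local and neither summand is all of P.
    Irreducibility then makes X a summand of this sum. As P is injective and indecomposable, two
    independent submodules cannot both be nonzero, so the complement vanishes and N lies in im (p
    a). *)
Lemma ar_left_largest (N : rsub P) : ~ rsub_full N -> rsub_le N (rim (p ** a)).
Proof.
move=> Nn; pose m := rcopair (p ** a) (rinc N).
have mn : ~ repi m.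
  move=> mE; have [s ms] := projective_lift (rid P) Pp mE.
  rewrite -[s]rpair_eta rcopair_rpair in ms.
  have [[g [_ fg]]|[g [_ fg]]] := indecomposable_local Pind ms.
    by case: (ar_left_not_epi (p := p) P0 Pp); rewrite -rcompA in fg; exact: retract_epi fg.
  apply: Nn => i x; rewrite -rcompA in fg; have [y <-] := retract_epi fg x.
  by apply/rincP; exists y.
have minc i (y : P i) : rim m i y -> exists z, rinc (rim m) i z = y by move/rincP.
have [i x|s sE] := @rhom_lift _ _ _ _ _ (rinc (rim m)) (p ** a) (@rinc_mono _ _ _ _).
  by apply: minc; exists (x, 0); rewrite /= /rcopair_fun linear0 addr0.
have [/split_monoP[r rs]|/split_epiP[r ir]] := ar_irreducible_left pq Pp (esym sE); last first.
  case: mn => i y; have [x <-] := retract_epi ir y.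
  by have := iffRL (rincP (rim m) _) (ex_intro _ x erefl).
have [C [c [d [dc rc ds sc]]]] := retract_complement rs.
have [_ pq'] := biproduct_riso rs dc rc ds sc.
have [|//|C0] := @injective_uniform P X C (p ** a) (rinc (rim m) ** c) Pi Pind.
  rewrite -sE -rcopair_comp => i x y /(@rinc_mono _ _ _ _ i).
  exact: retract_mono pq' i x y.
move=> i x Nx; have [y yx] := iffLR (rincP N _) Nx.
have [|z zx] := minc i x.
  by exists (0, y); rewrite /= /rcopair_fun linear0 add0r.
have sr : s ** r = rid _ by rewrite -sc (to_zero d C0) rcomph0 addr0.
exists (r i z); rewrite -sE -zx -[LHS]/(rinc (rim m) i ((s ** r) i z)) sr.
by [].
Qed.

(** Dual: the intersection of ker (b q) and N is nonzero, Z is a summand of the quotient of P by it,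
    and the complement vanishes because P is projective and indecomposable. *)
Lemma ar_right_least (N : rsub P) : ~ rsub_null N -> rsub_le (rker (b ** q)) N.
Proof.
move=> Nn; pose m := rpair (b ** q) (rprj N).
have mn : ~ rmono m.
  move=> mI; have [r rm] := injective_extend (rid P) Pi mI.
  rewrite -[r]rcomph1 -dsum_id rcompDr !rcompA rcompDl -!rcompA rfst_rpair rsnd_rpair in rm.
  have [[g [gf _]]|[g [gf _]]] := indecomposable_local Pind rm.
    by case: (ar_right_not_mono (q := q) P0 Pp Pi); rewrite !rcompA -rcompA in gf;
      exact: retract_mono gf.
  apply: Nn => i x Nx; rewrite !rcompA in gf.
  by apply: (rmono_eq0 (retract_mono gf)); apply/rprjP.
have [i x|t tE] := @rhom_factor _ _ _ _ _ (rprj (rker m)) (b ** q) (@rprj_epi _ _ _ _).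
  by move=> /(rprjP (rker m)) [].
have [/split_monoP[r rs]|/split_epiP[s ts]] := ar_irreducible_right pq Pp (esym tE).
  case: mn; apply: rmono0 => i x mx.
  by apply: (rmono_eq0 (retract_mono rs)); apply/(rprjP (rker m)).
have [C [c [d [dc rc ds sc]]]] := retract_complement ts.
have [_ pq'] := biproduct_riso ts dc rc ds sc.
have [|//|C0] := @projective_local P Z C (b ** q) (d ** rprj (rker m)) Pp Pind.
  rewrite -tE -rpair_comp => i z; have [y <-] := retract_epi pq' z.
  by have [x <-] := @rprj_epi _ _ _ (rker m) i y; exists x.
have st : s ** t = rid _ by rewrite -sc (to_zero d C0) rcomph0 addr0.
move=> i x /= bqx; have : rprj (rker m) i x = 0.
  rewrite -[LHS]/((rid _) i (rprj (rker m) i x)) -st.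
  by rewrite -[LHS]/(s i ((t ** rprj (rker m)) i x)) tE /= bqx linear0.
by move=> /(rprjP (rker m)) [_ /rprjP].
Qed.

(** A largest proper submodule is the only maximal one, so the intersection defining the radical is
    im (p a), a copy of X. *)
Lemma ar_radical : riso X (sub_rmod (rradical P)).
Proof.
have radE i x : rradical P i x <-> rim (p ** a) i x.
  split=> [|ax N [Nf Nmax]].
    apply; split=> [af|N' aN'].
      by apply: (ar_left_not_epi (p := p) P0 Pp) => j y; exact: af.
    have [|N'n] := pselect (rsub_full N'); first by right.
    by left; exact: ar_left_largest.
  have [|aN] := Nmax (rim (p ** a)) (ar_left_largest Nf); first exact.
  by case: (ar_left_not_epi (p := p) P0 Pp) => j y; exact: aN.
have [i x|w wE] := @rhom_lift _ _ _ _ _ (rinc (rradical P)) (p ** a) (@rinc_mono _ _ _ _).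
  by apply: (iffLR (rincP (rradical P) _)); apply/radE; exists x.
have aI := ar_left_mono pq P0 Pp.
have [|i y|g wg] := @bij_rinv _ _ _ _ w; last exact: riso_rinv wg.
  by move=> i x y wxy; apply: aI; rewrite -wE /= wxy.
have /radE[x xy] := iffRL (rincP (rradical P) _) (ex_intro _ y erefl).
by exists x; apply: (@rinc_mono _ _ _ (rradical P)); rewrite -xy -wE.
Qed.

(** A least nonzero submodule is the only simple one, so the socle is ker (b q), whose quotient is
    Z. *)
Lemma ar_socle : riso Z (quo_rmod (rsocle P)).
Proof.
have kn : ~ rsub_null (rker (b ** q)).
  by move=> k0; apply: (ar_right_not_mono (q := q) P0 Pp Pi); apply: rmono0.
have socE i x : rsocle P i x <-> rker (b ** q) i x.
  split=> [|kx N SN].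
    by apply=> S [Sn Smin]; have [//|] := Smin _ (ar_right_least Sn).
  apply: (SN (rker (b ** q))) kx; split=> // N' _.
  have [|N'n] := pselect (rsub_null N'); first by left.
  by right; exact: ar_right_least.
have [i x /(rprjP (rsocle P))/socE //|w wE] :=
  @rhom_factor _ _ _ _ _ (rprj (rsocle P)) (b ** q) (@rprj_epi _ _ _ _).
have bqE := ar_right_epi pq P0 Pp Pi.
have [|i y|g [gw wg]] := @bij_rinv _ _ _ _ w; last exact: (riso_rinv (conj wg gw)).
  apply: rmono0 => i y; have [x <-] := @rprj_epi _ _ _ (rsocle P) i y.
  rewrite -[w i _]/((w ** rprj (rsocle P)) i x) wE => bqx.
  by apply/(rprjP (rsocle P))/socE.
by have [x <-] := bqE i y; exists (rprj (rsocle P) i x); rewrite -wE.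
Qed.

End Indecomposable.
End ProjectivePart.
End AlmostSplit.

(** * The sequence of an Auslander-Reiten triangle *)

Lemma ar_triangle_sequence (K : fieldType) (L : falgType K) (H : inj_hulls L)
    (M M' M'' Y : rmod L) (h : rhom M M') (h' : rhom M' M'') (h'' : rhom M'' (Om H M))
    (a : rhom M Y) (b : rhom Y M'') (c : rhom Y M') (t : rhom M'' (Om H M)) :
    AR_triangle (Triangle h h' h'') ->
    no_projective_summand M -> no_projective_summand M'' ->
    ses a b -> connecting a b t -> stable_iso c ->
    stable_eq (h' ** c) b -> stable_eq t h'' ->
  AR_sequence a b.
Proof.
move=> [_ [/= Mi M''i] h''n ras] Mn M''n ab abt [c' [c'c cc']] h'c th''.
(* A section of b would make t = t b s factor through the hull of M, so [h''] would be stably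
   zero. *)
have bn : ~ split_epi b.
  move=> /split_epiP[s bs]; apply: h''n; apply: stable_trans (stable_sym th'') _.
  have /connectingP[v [_ tb]] := abt.
  apply/stable_eqE; rewrite -[rzero _ _]/(0 : rhom _ _) subr0.
  rewrite -[t]rcomph1 -bs rcompA tb rcompNl -rcompA.
  exact/factors_projinjN/factors_hull.
(* A stable section of u can be made strict, so u does not split stably and lifts up to an error.
   The error factors through a projective and is lifted along b separately. *)
have bras N (u : rhom N M'') : ~ split_epi u -> exists v, req u (b ** v).
  move=> un; have [[s us]|v uv] := ras N u.
    have [s' us' _] := stable_retract_lift M''n us.
    by apply: un; apply/split_epiP; exists s'.
  have ubv : stable_eq u (b ** (c' ** v)).
    apply: stable_trans uv _; rewrite rcompA; apply: stable_compr.
    apply: stable_trans (stable_compr c' h'c); rewrite -rcompA.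
    by have := stable_sym (stable_compl h' cc'); rewrite rcomph1.
  have /stable_eqE/factors_projinjP[P [f [g [Pp _ E]]]] := ubv.
  have [g' bg'] := projective_lift g Pp (ses_epi ab).
  exists (c' ** v + g' ** f); suff {1}-> : u = b ** (c' ** v + g' ** f) by [].
  by rewrite rcompDr [b ** (g' ** f)]rcompA bg' -E addrC subrK.
split=> //.
  move=> /split_monoP ra; apply: bn; apply/split_epiP.
  exact: (iffLR (ses_split ab) ra).
exact: left_almost_split (stable_indecomposable_strict Mn Mi) bn bras.
Qed.

Theorem theorem2p7 (K : closedFieldType) (L : falgType K) (Lbasic : basic L)
    (H : inj_hulls L) (M M' M'' : rmod L)
    (h : rhom M M') (h' : rhom M' M'') (h'' : rhom M'' (Om H M))
    (T_AR : AR_triangle (Triangle h h' h''))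
    (noprojM : no_projective_summand M)
    (noprojM' : no_projective_summand M')
    (noprojM'' : no_projective_summand M'') :
  exists (P : rmod L) (alpha : rhom M P)
         (g : rhom M' M'') (beta : rhom P M''),
    [/\ projective_rmod P,
        AR_sequence (rpair h alpha) (rcopair g beta),
        induces (rpair h alpha) (rcopair g beta) (Triangle h h' h'')
      & ~ is_zero P ->
          [/\ indecomposable P,
              riso M (sub_rmod (rradical P))
            & riso M'' (quo_rmod (rsocle P))]].
Proof.
have [T_dist [/= Mi M''i] _ _] := T_AR.
have [P [alpha [g [beta [t [[Pp Pi] ab abt h'b th'']]]]]] :=
  distinguished_ses_pair T_dist noprojM noprojM' noprojM''.
have pi : stable_iso (rfst M' P).
  apply: (stable_iso_retract (s := rinl M' P) _ _).2; first by rewrite rfst_rpair.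
  apply/stable_eqE; rewrite -dsum_id opprD addNKr.
  apply/factors_projinjN/factors_projinjP.
  by exists P, (rsnd M' P), (rinr M' P).
have ar := ar_triangle_sequence T_AR noprojM noprojM'' ab abt pi h'b th''.
exists P, alpha, g, beta; split=> //.
  (* The isomorphism of triangles is the identity at both ends and the projection M' ⊕ P -> M' in
     the middle, a stable isomorphism because P is stably zero. *)
  exists t; split=> //; exists (rid M), (rfst M' P), (rid M''), (rid (Om H M)).
  split=> /=.
  - by split=> //; exact: stable_iso_id.
  - exact: Om_mor_id.
  - by rewrite rfst_rpair rcomph1; exact: stable_refl.
  - by rewrite rcomp1h; exact: stable_sym.
  - by rewrite rcomp1h rcomph1.
move=> P0; have [M0 _] := stable_indecomposable_strict noprojM Mi.
have [M''0 _] := stable_indecomposable_strict noprojM'' M''i.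
have pq : rsnd M' P ** rinr M' P = rid P by rewrite rsnd_rpair.
split.
- exact: (ar_projective_indecomposable ar noprojM noprojM'' pq).
- exact: (ar_radical ar noprojM noprojM'' pq).
- exact: (ar_socle ar noprojM noprojM'' pq).
Qed.
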